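(* There is an absolute constant $C>0$ such that the following holds. Let $n$ and $k$ be integers with $1\le k\le n-1$, let $A=\{a_1,\dots,a_n\}$ be a set of $n$ distinct real numbers, and let $S$ be the sum of $k$ elements of $A$ chosen uniformly at random without replacement (that is, $S$ is the sum of the elements of a uniformly random $k$-element subset of $A$). Then for any $x\in\mathbb{R}$, $$\mathbb{P}(S=x)\le \frac{C}{n\sqrt{\min(k,n-k)}}.$$ *)

(* Defs.v *)
From HB Require Import structures.
From mathcomp Require Import all_boot all_order all_algebra.
From mathcomp Require Import finmap.
From mathcomp Require Import reals.

Set Implicit Arguments.
Unset Strict Implicit.
Unset Printing Implicit Defensive.

Import Order.TTheory GRing.Theory Num.Theory.
Local Open Scope ring_scope.

(* 0 by convention when Omega is empty, since 0^-1 = 0. *)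
Definition unif_prob (R : realType) (T : finType) (Omega : {set T})
    (E : {pred T}) : R :=
  #|[set w in Omega | w \in E]|%:R / #|Omega|%:R.

(* The finite set A is coerced to the finType of its elements, so a subset of
   A is a term of type {set A}. *)
Definition ksubsets (R : realType) (A : {fset R}) (k : nat) : {set {set A}} :=
  [set B : {set A} | #|B| == k].

Definition subset_sum (R : realType) (A : {fset R}) (B : {set A}) : R :=
  \sum_(b in B) val b.

(* Main.v *)
Require Import Defs.
From HB Require Import structures.
From mathcomp Require Import all_boot all_order all_algebra.
From mathcomp Require Import finmap.
From mathcomp Require Import reals.
From mathcomp Require Import algC cyclotomic zify ring lra.

Set Implicit Arguments.
Unset Strict Implicit.
Unset Printing Implicit Defensive.

Import Order.TTheory GRing.Theory Num.Theory.
Local Open Scope ring_scope.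

(** The proof compares drawing without replacement with drawing independently.

    Independent draws.  Let A have n = 2h elements.  The m-tuples of elements
    of A split into chains along which the sum strictly increases, so at most
    one tuple of each chain has a given sum.  The lengths of the chains, hence
    their number, depend only on n and m, and may be computed for
    A = {0, .., n-1}.  There every chain is a run of consecutive sums centred
    at the middle, so the number of chains is the middle coefficient of
    [n]^m, where [n] = 1 + X + .. + X^(n-1).  From [2h] = [h] (1 + X^h) that
    coefficient is at most C(m, m/2) h^(m-1) ([coef_sumset_pow_le]): a sum of m
    independent draws has no atom larger than a constant over n sqrt m.

    Few draws.  If k^2 <= h, then k draws are distinct with probability at
    least 1/2, and the bound transfers directly ([even_case_sparse]).

    Many draws.  Select every element of A independently with probability
    q = k/n.  The selected set has k elements with probability at least a
    constant over sqrt k ([binomial_mode_ge]), so it suffices to bound the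
    coefficients of the product of the factors 1 - q + q X^a over a in A by a
    constant over n k.  Such a coefficient is at most the mean of the absolute
    value of the product at X = w, over the N-th roots of unity w.  By the inequality
    between arithmetic and geometric means that absolute value is at most
    (1 - 2d + d (g + conj g))^h, where d = q (1 - q) and g is the mean of w^a
    over a in A.  The mean of this last expression is the probability that a
    walk with h steps is back at its origin, where a step is null with
    probability 1 - 2d, and otherwise is a uniform element of A or the opposite
    of one.  To be back after T moves, the walk needs T/2 moves of each sign,
    which has probability O(1 / sqrt T), and then two sums of T/2 independent
    draws have to agree, which has probability O(1 / (n sqrt T)).  The product
    is O(1 / (n T)), and the mean of 1 / (T + 1) is O(1/k)
    ([inverse_moment]).  The event T = 0 is negligible because k^2 >= h
    ([exp_negligible]).

    Reductions.  The roots of unity require integers: real numbers are replaced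
    by integers that satisfy the same coincidences between sums of equally many
    terms, by simultaneous Diophantine approximation ([integer_model]).  Adding
    a large constant to these integers makes sums of different numbers of terms
    different, so that a walk at its origin has made equally many moves of each
    sign.  A set of odd size is handled by averaging over the deletion of one
    element, and k > n/2 by complementation. *)

(** * Chains of tuples with increasing sums *)

Definition sumset_poly (s : seq nat) : {poly rat} := \sum_(x <- s) 'X^x.

(** The elements of [s], increasing, and [a], decreasing, index the rows and the
    columns of a rectangle of sums.  The rectangle is cut into hooks: the first
    one goes along the first row from the smallest element of [a] to the
    largest, then down the column of the largest element of [a]; removing that
    row and that column leaves a smaller rectangle. *)
Fixpoint hooks (s a : seq nat) : seq (seq nat) :=
  match s, a with
  | x :: s', y :: a' =>
      (rev [seq (x + b)%N | b <- a'] ++ [seq (t + y)%N | t <- x :: s'])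
        :: hooks s' a'
  | _, _ => [::]
  end.

Lemma sumset_poly_cat s t : sumset_poly (s ++ t) = sumset_poly s + sumset_poly t.
Proof. by rewrite /sumset_poly big_cat. Qed.

Lemma sumset_poly_rev s : sumset_poly (rev s) = sumset_poly s.
Proof. by apply: perm_big; rewrite perm_rev. Qed.

Lemma sumset_poly_cons x s : sumset_poly (x :: s) = 'X^x + sumset_poly s.
Proof. by rewrite /sumset_poly big_cons. Qed.

Lemma sumset_poly_addl x s :
  sumset_poly [seq (x + b)%N | b <- s] = 'X^x * sumset_poly s.
Proof. by rewrite /sumset_poly big_map mulr_sumr; apply: eq_bigr => b _; rewrite exprD. Qed.

Lemma sumset_poly_addr x s :
  sumset_poly [seq (t + x)%N | t <- s] = sumset_poly s * 'X^x.
Proof. by rewrite /sumset_poly big_map mulr_suml; apply: eq_bigr => b _; rewrite exprD. Qed.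

Lemma hooks_poly s a :
  sumset_poly s * sumset_poly a = \sum_(c <- hooks s a) sumset_poly c.
Proof.
have nil0 : sumset_poly [::] = 0 by rewrite /sumset_poly big_nil.
elim: s a => [|x s IH] [|y a] /=; rewrite ?big_nil ?nil0 ?mul0r ?mulr0 //.
rewrite big_cons -IH sumset_poly_cat sumset_poly_rev sumset_poly_addl.
rewrite !sumset_poly_cons sumset_poly_addr exprD; ring.
Qed.

Lemma hooks_sorted s a :
  sorted ltn s -> sorted gtn a -> all (sorted ltn) (hooks s a).
Proof.
elim: s a => [|x s IH] [|y a] //= xs ya.
have := xs; rewrite (path_sortedE ltn_trans) => /andP[xs1 ss].
have gt_trans : transitive gtn by move=> u v w /= ? ?; apply: (@ltn_trans u).
have := ya; rewrite (path_sortedE gt_trans) => /andP[ya1 sa].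
rewrite IH // andbT (sorted_pairwise ltn_trans) pairwise_cat; apply/and3P; split.
- apply/allrelP => u v; rewrite mem_rev => /mapP[b ba ->].
  rewrite inE => /orP[/eqP->|/mapP[t ts ->]].
    by move/allP: ya1 => /(_ _ ba) /=; lia.
  by move/allP: ya1 => /(_ _ ba) /=; move/allP: xs1 => /(_ _ ts) /=; lia.
- rewrite -(sorted_pairwise ltn_trans) rev_sorted.
  rewrite sorted_map; apply: (sub_sorted _ sa) => u v /=; lia.
- rewrite -(sorted_pairwise ltn_trans) .
  rewrite -[_ :: _]/(map (addn^~ y) (x :: s)) sorted_map.
  by apply: (@sub_path _ ltn _ _ x s xs) => u v /=; rewrite ltn_add2r.
Qed.

Fixpoint hook_sizes (c n : nat) : seq nat :=
  match c, n with
  | c'.+1, n'.+1 => (c + n')%N :: hook_sizes c' n'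
  | _, _ => [::]
  end.

Lemma map_size_hooks s a : map size (hooks s a) = hook_sizes (size s) (size a).
Proof.
elim: s a => [|x s IH] [|y a] //=.
by rewrite IH size_cat size_rev /= !size_map addnC.
Qed.

(** Only the sums of the tuples along each chain are recorded. *)
Fixpoint chains (a : seq nat) (m : nat) : seq (seq nat) :=
  if m is m'.+1 then flatten [seq hooks s a | s <- chains a m'] else [:: [:: 0%N]].

Lemma chains_poly a m :
  sumset_poly a ^+ m = \sum_(c <- chains a m) sumset_poly c.
Proof.
elim: m => [|m IH] /=; first by rewrite big_seq1 /sumset_poly big_seq1.
rewrite exprSr IH big_flatten big_map mulr_suml.
by apply: eq_bigr => c _; rewrite hooks_poly.
Qed.

Lemma chains_sorted a m : sorted gtn a -> all (sorted ltn) (chains a m).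
Proof.
move=> sa; elim: m => [//|m IH] /=.
apply/allP => c /flattenP[_ /mapP[s /(allP IH) ss ->]].
exact/allP/hooks_sorted.
Qed.

(** This transfers the number of chains from an initial segment of the integers
    to an arbitrary set of the same size. *)
Lemma map_size_chains a b m :
  size a = size b -> map size (chains a m) = map size (chains b m).
Proof.
move=> ab; elim: m => [//|m IH] /=.
rewrite !map_flatten -!map_comp.
have E d : map (map size \o (hooks^~ d)) (chains d m) =
   map (hook_sizes^~ (size d)) (map size (chains d m)).
  by rewrite -map_comp; apply: eq_map => s /=; rewrite map_size_hooks.
by rewrite !E IH ab.
Qed.

Lemma coef_sumset_poly s u : (sumset_poly s)`_u = (count_mem u s)%:R.
Proof.
rewrite /sumset_poly coef_sum -sum1_count natr_sum [RHS]big_mkcond /=.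
by apply: eq_bigr => x _; rewrite coefXn eq_sym; case: eqP.
Qed.

(** A chain is strictly increasing, so it contains each value at most once. *)
Lemma coef_le_size_chains a m u :
  sorted gtn a -> (sumset_poly a ^+ m)`_u <= (size (chains a m))%:R.
Proof.
move=> sa; rewrite chains_poly coef_sum.
apply: (@le_trans _ _ (\sum_(c <- chains a m) 1)); last first.
  by rewrite big_const_seq count_predT iter_addr addr0.
rewrite big_seq [leRHS]big_seq; apply: ler_sum => c cm.
rewrite coef_sumset_poly count_uniq_mem; first by case: (_ \in _).
by apply: sorted_uniq (allP (chains_sorted m sa) _ cm); [exact: ltn_trans|exact: ltnn].
Qed.

Definition dec_iota n := rev (iota 0 n).

Lemma dec_iotaS n : dec_iota n.+1 = n :: dec_iota n.
Proof. by rewrite /dec_iota -addn1 iotaD rev_cat. Qed.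

(** Each hook keeps the centre [u + (c - 1) / 2 + (n - 1) / 2] of the
    rectangle: this is what the second conjunct says. *)
Lemma hooks_iota u c n s : s \in hooks (iota u c) (dec_iota n) ->
  exists v l, [/\ s = iota v l.+1 & (v.*2 + l.+2 = u.*2 + c + n)%N].
Proof.
elim: c u n => [|c IH] u [|n] //; rewrite dec_iotaS /= inE => /orP[/eqP->|/IH].
  exists u, (n + c)%N; split; last lia.
  transitivity (iota u (n + c.+1)); last by rewrite addnS.
  rewrite iotaD; congr (_ ++ _).
    by rewrite -map_rev /dec_iota revK -iotaDl addn0.
  rewrite /=; congr cons.
  by under eq_map do rewrite addnC; rewrite -iotaDl; congr iota; lia.
by move=> [v [l [-> E]]]; exists v, l; split=> //; lia.
Qed.

(** All chains are runs of integers centred at [m (n - 1) / 2]. *)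
Lemma chains_iota n m s : s \in chains (dec_iota n) m ->
  exists v l, s = iota v l.+1 /\ (v.*2 + l + m = m * n)%N.
Proof.
elim: m s => [|m IH] s /=; first by rewrite inE => /eqP->; exists 0, 0.
move=> /flattenP[_ /mapP[c /IH[v [l [-> E]]] ->] /hooks_iota[v' [l' [-> E']]]].
by exists v', l'; split=> //; lia.
Qed.

(** Every chain contains the middle value exactly once. *)
Lemma size_chains_dec_iota n m : (0 < n)%N ->
  (size (chains (dec_iota n) m))%:R =
  (sumset_poly (dec_iota n) ^+ m)`_((m * n.-1)./2).
Proof.
move=> n0; rewrite chains_poly coef_sum.
rewrite -sum1_size natr_sum big_seq [RHS]big_seq; apply: eq_bigr => c cm.
have [v [l [-> E]]] := chains_iota cm.
rewrite coef_sumset_poly count_uniq_mem ?iota_uniq // mem_iota.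
suff -> : (v <= (m * n.-1)./2 < v + l.+1)%N by [].
have := half_leq (leqnn (m * n.-1)); have := odd_double_half (m * n.-1).
have : (m * n.-1 + m = m * n)%N by rewrite -mulnSr prednK.
by case: odd; lia.
Qed.

(** * Binomial coefficients and binomial means *)

Lemma bin_le_central m j : ('C(m, j) <= 'C(m, m./2))%N.
Proof.
have up i : (i <= m./2)%N -> ('C(m, m./2 - i) <= 'C(m, m./2))%N.
  elim: i => [|i IH] im; first by rewrite subn0.
  apply: leq_trans (IH (ltnW im)).
  have E : (m./2 - i = (m./2 - i.+1).+1)%N by lia.
  rewrite E; move: (m./2 - i.+1)%N E => r E.
  have hm := odd_double_half m.
  rewrite -(@leq_pmul2l r.+1) // mul_bin_left leq_mul2r; apply/orP; right; lia.
have [jm|mj] := leqP j m./2; first by have := up (m./2 - j)%N; rewrite subKn //; apply; lia.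
have [jm|mj'] := leqP j m; last by rewrite bin_small.
have hm := odd_double_half m.
by rewrite -bin_sub //; have := up (m./2 - (m - j))%N; rewrite subKn; [apply|]; lia.
Qed.

(** The factor [3 i + 1] is chosen for the induction to close:
    [4 (2i+1)^2 (3i+4) <= 16 (i+1)^2 (3i+1)]. *)
Lemma bin_double_sq i : ('C(i.*2, i) ^ 2 * (3 * i + 1) <= 4 ^ i.*2)%N.
Proof.
elim: i => [//|i IH]; rewrite doubleS.
have E : (i.+1 * 'C(i.*2.+2, i.+1) = 2 * i.*2.+1 * 'C(i.*2, i))%N.
  have e2 : (i.*2.+2 * 'C(i.*2.+1, i) = i.+1 * 'C(i.*2.+2, i.+1))%N := mul_bin_diag _ _.
  have e1 : (i.+1 * 'C(i.*2.+1, i) = i.*2.+1 * 'C(i.*2, i))%N.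
    by rewrite (mul_bin_down i.*2.+1 i); congr (_ * _)%N; lia.
  by rewrite -e2 -mulnA -e1 mulnA; congr (_ * _)%N; lia.
rewrite -(@leq_pmul2l (i.+1 ^ 2 * (3 * i + 1))); last by rewrite muln_gt0 expn_gt0 addn1.
have -> : (i.+1 ^ 2 * (3 * i + 1) * ('C(i.*2.+2, i.+1) ^ 2 * (3 * i.+1 + 1)) =
  (3 * i + 1) * (3 * i + 4) * (i.+1 * 'C(i.*2.+2, i.+1)) ^ 2)%N by ring.
rewrite E.
have -> : ((3 * i + 1) * (3 * i + 4) * (2 * i.*2.+1 * 'C(i.*2, i)) ^ 2 =
  4 * i.*2.+1 ^ 2 * (3 * i + 4) * ('C(i.*2, i) ^ 2 * (3 * i + 1)))%N by ring.
rewrite !(expnS 4); move: IH; move: ('C(_, _) ^ 2 * _)%N (4 ^ _)%N => x y xy.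
apply: (@leq_trans (4 * i.*2.+1 ^ 2 * (3 * i + 4) * y)%N); first by rewrite leq_mul2l xy orbT.
rewrite mulnCA !mulnA leq_mul2r; apply/orP; right; nia.
Qed.

Lemma bin_central_sq m : ('C(m, m./2) ^ 2 * m.+1 <= 4 ^ m)%N.
Proof.
have [i [->|->]] : exists i, m = i.*2 \/ m = i.*2.+1.
  by exists m./2; have := odd_double_half m; case: odd; [right|left]; lia.
  rewrite doubleK; apply: leq_trans (bin_double_sq i).
  by rewrite leq_mul2l; apply/orP; right; lia.
rewrite /= uphalf_double.
have := bin_double_sq i.+1; rewrite doubleS.
have -> : ('C(i.*2.+2, i.+1) = 2 * 'C(i.*2.+1, i))%N.
  have e : (i.*2.+2 * 'C(i.*2.+1, i) = i.+1 * 'C(i.*2.+2, i.+1))%N := mul_bin_diag _ _.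
  by apply/eqP; rewrite -(@eqn_pmul2l i.+1) // -e mulnA; apply/eqP; congr (_ * _)%N; lia.
rewrite (expnS 4 i.*2.+1); nia.
Qed.

(** The first binomial is the number of sign patterns with equally many signs of
    each kind, the second one comes from the atoms of a sum of [i] draws; each
    of them saves a factor of order [sqrt i]. *)
Lemma bin_central_mul i :
  ('C(i.*2, i) * 'C(i, i./2) * i.+1 <= 8 ^ i)%N.
Proof.
rewrite -(@leq_exp2r _ _ 2) // !expnMn.
have h1 := bin_central_sq i; have h2 := bin_central_sq i.*2.
rewrite doubleK in h2.
have -> : ((8 ^ i) ^ 2 = 4 ^ i.*2 * 4 ^ i)%N.
  by rewrite -expnD -!expnM -(expnM 2 3) -(expnM 2 2); congr (_ ^ _)%N; lia.
apply: leq_trans (leq_mul h2 h1).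
have -> : ('C(i.*2, i) ^ 2 * i.*2.+1 * ('C(i, i./2) ^ 2 * i.+1) =
  'C(i.*2, i) ^ 2 * 'C(i, i./2) ^ 2 * (i.*2.+1 * i.+1))%N by ring.
by rewrite leq_mul2l; apply/orP; right; rewrite -mulnn leq_mul2r; lia.
Qed.

(** This is the mean of [1 / (T + 1)] for a binomial variable [T]; the identity
    [C(h, T) / (T + 1) = C(h + 1, T + 1) / (h + 1)] turns it into a part of the
    expansion of [((1 - p) + p) ^ (h + 1)]. *)
Lemma inverse_moment (p : rat) h : 0 < p <= 1 ->
  \sum_(T < h.+1) (1 - p) ^+ (h - T) * p ^+ T *+ 'C(h, T) / T.+1%:R
    <= (h.+1%:R * p)^-1.
Proof.
move=> /andP[p0 p1].
have h0 : 0 < h.+1%:R :> rat by rewrite ltr0n.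
rewrite -(@ler_pM2r _ (h.+1%:R * p)) ?mulr_gt0 // mulVf ?gt_eqF ?mulr_gt0 //.
rewrite mulr_suml.
rewrite -[leRHS](expr1n _ h.+1) -[X in _ <= X ^+ _](subrK p) exprDn [leRHS]big_ord_recl.
apply: (@le_trans _ _ (\sum_(i < h.+1)
   (1 - p) ^+ (h.+1 - lift ord0 i) * p ^+ lift ord0 i *+ 'C(h.+1, lift ord0 i))).
  rewrite le_eqVlt; apply/orP; left; apply/eqP; apply: eq_bigr => T _.
  rewrite lift0 subSS exprS.
  have e : h.+1%:R * 'C(h, T)%:R = T.+1%:R * 'C(h.+1, T.+1)%:R :> rat.
    by rewrite -!natrM mul_bin_diag.
  have t0 : T.+1%:R != 0 :> rat by rewrite pnatr_eq0.
  rewrite -!(mulr_natr (_ * _)).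
  move: ((1 - p) ^+ (h - T)) (p ^+ T) ('C(h, T)%:R : rat) e => r s b e.
  transitivity (r * s * p / T.+1%:R * (h.+1%:R * b)); first by field; rewrite nat1r.
  by rewrite e; field; rewrite nat1r.
have t0 : 0 <= (1 - p) ^+ (h.+1 - 0) * p ^+ 0 *+ 'C(h.+1, 0).
  by rewrite mulrn_wge0 // mulr_ge0 // exprn_ge0 // subr_ge0.
by rewrite lerDr.
Qed.

(** * Atoms of a sum of independent uniform picks *)

Lemma coef_sumset_pow_ge0 s m u : 0 <= (sumset_poly s ^+ m)`_u.
Proof.
rewrite chains_poly coef_sum; apply: sumr_ge0 => c _.
by rewrite coef_sumset_poly ler0n.
Qed.

Lemma coefM_le (p q r : {poly rat}) :
  (forall i, 0 <= r`_i) -> (forall i, p`_i <= q`_i) ->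
  forall i, (r * p)`_i <= (r * q)`_i.
Proof.
by move=> r0 pq i; rewrite !coefM; apply: ler_sum => j _; apply: ler_wpM2l.
Qed.

Lemma coefM_le_horner1 (p q : {poly rat}) u :
  (forall i, p`_i <= 1) -> (forall i, 0 <= q`_i) -> (p * q)`_u <= q.[1].
Proof.
move=> p1 q0; rewrite mulrC coefM.
apply: (@le_trans _ _ (\sum_(j < u.+1) q`_j)).
  by apply: ler_sum => j _; rewrite -[leRHS]mulr1 ler_wpM2l.
rewrite horner_coef; under [leRHS]eq_bigr do rewrite expr1n mulr1.
case: (leqP u.+1 (size q)) => us.
  rewrite (big_ord_widen _ (fun j => q`_j) us) big_mkcond /=.
  by apply: ler_sum => j _; case: ifP.
rewrite [leRHS](big_ord_widen _ (fun j => q`_j) (ltnW us)) [leRHS]big_mkcond /=.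
by apply: ler_sum => j _; case: ltnP => // sj; rewrite nth_default.
Qed.

Lemma dec_iota_poly n : sumset_poly (dec_iota n) = \sum_(i < n) 'X^i.
Proof. by rewrite /dec_iota sumset_poly_rev /sumset_poly -[n in iota _ n]subn0 -/(index_iota 0 n) big_mkord. Qed.

Lemma coef_dec_iota n i : (sumset_poly (dec_iota n))`_i <= 1.
Proof.
rewrite coef_sumset_poly count_uniq_mem ?rev_uniq ?iota_uniq //.
by case: (_ \in _).
Qed.

(** Division with remainder by [h]: the polynomial [[h]] times the sum of the
    powers of [X^h] is again of the form [[n]]. *)
Lemma dec_iota_mul h l :
  sumset_poly (dec_iota h) * \sum_(j < l) 'X^(h * j) = sumset_poly (dec_iota (h * l)).
Proof.
elim: l => [|l IH]; first by rewrite big_ord0 muln0 mulr0 /sumset_poly big_nil.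
rewrite big_ord_recr mulrDr /= IH.
rewrite mulnS addnC !dec_iota_poly big_split_ord /=; congr (_ + _).
by rewrite mulr_suml; apply: eq_bigr => i _; rewrite -exprD addnC.
Qed.

(** With [[2h] = [h] (1 + X^h)], replace each coefficient of [(1 + X^h)^(m+1)] by
    the central binomial coefficient; one factor [[h]] times the sum of the
    [X^(hj)] has coefficients at most 1, and the value at 1 of the remaining
    power of [[h]] is [h^m]. *)
Lemma coef_dec_iota_pow h m u :
  (sumset_poly (dec_iota h.*2) ^+ m.+1)`_u <= ('C(m.+1, m.+1./2) * h ^ m)%:R.
Proof.
have -> : sumset_poly (dec_iota h.*2) = sumset_poly (dec_iota h) * (1 + 'X^h).
  have := dec_iota_mul h 2; rewrite big_ord_recr big_ord1 /= muln0 muln1 muln2 => <-.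
  by rewrite expr0.
rewrite exprMn exprS mulrAC mulrC.
apply: (@le_trans _ _ (sumset_poly (dec_iota h) ^+ m * (sumset_poly (dec_iota h) *
   ('C(m.+1, m.+1./2)%:R *: \sum_(j < m.+2) 'X^(h * j))))`_u).
  apply: coefM_le => [i|i]; first exact: coef_sumset_pow_ge0.
  apply: coefM_le => {i}[i|i]; first by rewrite -(expr1 (sumset_poly _)) coef_sumset_pow_ge0.
  rewrite exprDn coefZ !coef_sum mulr_sumr; apply: ler_sum => j _.
  rewrite expr1n mul1r -exprM coefMn coefXn -[_ *+ 'C(_, _)]mulr_natl.
  by apply: ler_wpM2r; [case: (_ == _)|rewrite ler_nat bin_le_central].
rewrite -scalerAr -scalerAr coefZ dec_iota_mul mulrC natrM mulrC.
rewrite ler_wpM2l ?ler0n // mulrC.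
apply: le_trans (coefM_le_horner1 _ _ _) _ => [i|i|].
- exact: coef_dec_iota.
- exact: coef_sumset_pow_ge0.
rewrite horner_exp dec_iota_poly horner_sum.
by under eq_bigr do rewrite hornerXn expr1n; rewrite sumr_const card_ord natrX.
Qed.

(** The coefficient counts the [m + 1]-tuples of elements of [D] with sum [u].  It
    is at most the number of chains, which for an initial segment of the
    integers is a coefficient of the same kind. *)
Lemma coef_sumset_pow_le (I : finType) (a : I -> nat) (D : {set I}) h m u :
  injective a -> #|D| = h.*2 ->
  ((\sum_(i in D) 'X^(a i)) ^+ m.+1 : {poly rat})`_u
    <= ('C(m.+1, m.+1./2) * h ^ m)%:R.
Proof.
move=> inja cD.
pose s := sort geq [seq a i | i <- enum D].
have ps : perm_eq s [seq a i | i <- enum D] by rewrite perm_sort.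
have -> : \sum_(i in D) 'X^(a i) = sumset_poly s.
  by rewrite /sumset_poly (perm_big _ ps) big_map big_enum.
have us : uniq s by rewrite (perm_uniq ps) map_inj_uniq ?enum_uniq.
have ss : sorted gtn s.
  rewrite -[s]revK rev_sorted ltn_sorted_uniq_leq rev_uniq us rev_sorted.
  by apply: sort_sorted => x y; rewrite /geq /= leq_total.
have sz : size s = size (dec_iota h.*2).
  by rewrite (perm_size ps) size_map -cardE size_rev size_iota.
apply: le_trans (coef_le_size_chains _ _ ss) _.
have -> : size (chains s m.+1) = size (chains (dec_iota h.*2) m.+1).
  by rewrite -(size_map size) (map_size_chains _ sz) size_map.
case: h cD sz => [|h] cD sz; last by rewrite size_chains_dec_iota // coef_dec_iota_pow.
rewrite ler_nat; suff -> : chains (dec_iota 0.*2) m.+1 = [::] by [].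
rewrite /=; elim: (chains _ m) => [//|c l IH] /=.
by rewrite IH; case: c.
Qed.

(** * The probability that a binomial variable equals its mean *)

Lemma falling3_ge0 N : 0 <= N%:R * (N%:R - 1) * (N%:R - 2) :> rat.
Proof.
case: N => [|[|[|N]]]; rewrite ?mul0r ?subrr ?mulr0 ?mul0r //.
rewrite -(addn3 N) natrD; have : 0 <= N%:R :> rat by [].
by move: (N%:R : rat) => y y0; rewrite !mulr_ge0 //; lra.
Qed.

Lemma bernoulli3 (x : rat) N : 0 <= x ->
  1 + N%:R * x + N%:R * (N%:R - 1) / 2 * x ^+ 2
    + N%:R * (N%:R - 1) * (N%:R - 2) / 6 * x ^+ 3 <= (1 + x) ^+ N.
Proof.
move=> x0; elim: N => [|N IH]; first by rewrite expr0; lra.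
have x4 : 0 <= N%:R * (N%:R - 1) * (N%:R - 2) * x ^+ 4 by rewrite mulr_ge0 ?exprn_ge0 ?falling3_ge0.
have x1 : 0 <= 1 + x by lra.
have := ler_wpM2r x1 IH; rewrite [(1 + x) ^+ N.+1]exprSr -[N.+1%:R]natr1 {IH}.
move: ((1 + x) ^+ N) (N%:R : rat) x4 => y z x4 h.
apply: le_trans h.
rewrite -subr_ge0 (_ : _ - _ = z * (z - 1) * (z - 2) * x ^+ 4 / 6); last by field.
lra.
Qed.

(** The square of [(1 + 1/n)^(n + 1/2)], which decreases to [e^2]; it is the
    quotient of [stirling_ratio n] by [stirling_ratio n.+1]. *)
Definition stirling_step n : rat := (n.+1%:R / n%:R) ^+ n.*2.+1.

(** With [u = n + 1], this reduces to
    [(1 + 1/u)^2 <= (1 + 1/(u^2 - 1))^(2u - 1)], which follows from the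
    terms of degree at most 3 of the binomial expansion. *)
Lemma stirling_step_le n : (0 < n)%N -> stirling_step n.+1 <= stirling_step n.
Proof.
move=> n0; rewrite /stirling_step.
have v0 : 0 < n%:R :> rat by rewrite ltr0n.
set u : rat := n.+1%:R.
have u2 : 2 <= u by rewrite (ler_nat _ 2).
have Eu2 : n.+2%:R = u + 1 by rewrite -[n.+2]addn1 natrD.
have Eu : n%:R = u - 1 by rewrite /u -natr1 addrK.
have d0 : 0 < u ^+ 2 - 1 by nra.
set r := n.+2%:R / u.
have r0 : 0 < r by rewrite divr_gt0 // Eu2; lra.
have -> : u / n%:R = r * (1 + (u ^+ 2 - 1)^-1).
  rewrite /r Eu2 Eu; field.
  by rewrite !gt_eqF //; lra.
rewrite doubleS (exprSr r n.*2.+2) (exprSr r n.*2.+1) -mulrA [leRHS]exprMn ler_pM2l ?exprn_gt0 //.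
have -> : r * r = (1 + u^-1) ^+ 2 by rewrite /r Eu2; field; rewrite gt_eqF //; lra.
apply: le_trans (bernoulli3 _ _); last by rewrite invr_ge0 ltW.
have -> : n.*2.+1%:R = 2 * u - 1 :> rat.
  by rewrite -natr1 -mul2n natrM Eu; ring.
rewrite -subr_ge0.
rewrite (_ : _ - _ = (u ^+ 4 + u ^+ 3 + 9 * u ^+ 2 - 9 * u - 3)
  / (3 * u ^+ 2 * (u ^+ 2 - 1) ^+ 2 * (u + 1))); last first.
  by field; rewrite !gt_eqF //; lra.
apply: divr_ge0; first by nra.
by rewrite !mulr_ge0 ?exprn_ge0 //; lra.
Qed.

Lemma stirling_step_gt0 n : (0 < n)%N -> 0 < stirling_step n.
Proof. by move=> n0; rewrite exprn_gt0 // divr_gt0 ?ltr0n. Qed.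

Lemma stirling_step_anti m n : (0 < m)%N -> (m <= n)%N -> stirling_step n <= stirling_step m.
Proof.
move=> m0 /subnKC <-; elim: (n - m)%N => [|d IH]; first by rewrite addn0.
by rewrite addnS; apply: le_trans IH; apply: stirling_step_le; rewrite addn_gt0 m0.
Qed.

(** By Stirling's formula this is comparable to [e^(-2n)]; in the quotients below
    these exponentials cancel. *)
Definition stirling_ratio n : rat := n`!%:R ^+ 2 / n%:R ^+ n.*2.+1.

Lemma stirling_ratioS n : (0 < n)%N ->
  stirling_ratio n.+1 * stirling_step n = stirling_ratio n.
Proof.
move=> n0; have v0 : n%:R != 0 :> rat by rewrite pnatr_eq0 -lt0n.
have u0 : n.+1%:R != 0 :> rat by rewrite pnatr_eq0.
rewrite /stirling_ratio /stirling_step factS natrM expr_div_n.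
have -> : (n.+1.*2.+1 = 2 + n.*2.+1)%N by lia.
rewrite exprD; have := expf_neq0 n.*2.+1 v0; have := expf_neq0 n.*2.+1 u0.
by move: (n.+1%:R ^+ n.*2.+1) (n%:R ^+ n.*2.+1) => a b a0 b0; field; rewrite a0 b0 nat1r u0.
Qed.

Lemma stirling_ratio_gt0 n : (0 < n)%N -> 0 < stirling_ratio n.
Proof.
by move=> n0; rewrite divr_gt0 // exprn_gt0 // ltr0n // fact_gt0.
Qed.

(** The quotient [stirling_ratio (k + m) / stirling_ratio m] increases with [m],
    because [stirling_step] decreases; for [m = 1] the claim is
    [stirling_step k <= stirling_step 1 = 8]. *)
Lemma stirling_ratioD k m : (0 < k)%N -> (0 < m)%N ->
  stirling_ratio k * stirling_ratio m <= 8 * stirling_ratio (k + m).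
Proof.
move=> k0; case: m => // m _; elim: m => [|m IH].
  have -> : stirling_ratio 1 = 1 by [].
  rewrite mulr1 addn1 -(stirling_ratioS k0) mulrC.
  apply: ler_wpM2r; first exact: ltW (stirling_ratio_gt0 _).
  by apply: le_trans (stirling_step_anti (isT : (0 < 1)%N) k0) _.
have pm : 0 < stirling_step m.+1 by rewrite stirling_step_gt0.
rewrite -(ler_pM2r pm) -mulrA stirling_ratioS //; apply: le_trans IH _.
rewrite [(k + m.+2)%N]addnS -(@stirling_ratioS (k + m.+1)) ?addn_gt0 ?k0 // -[leRHS]mulrA.
rewrite ler_pM2l // ler_pM2l ?stirling_ratio_gt0 ?addnS //.
by apply: stirling_step_anti => //; lia.
Qed.

(** A binomial variable with parameters [n] and [k / n] equals its mean [k] with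
    probability at least [1 / sqrt (8 k)]. *)
Lemma binomial_mode_ge k m (n := (k + m)%N) (q : rat := k%:R / n%:R) :
  (0 < k)%N -> (0 < m)%N ->
  1 <= 8 * k%:R * ('C(n, k)%:R * q ^+ k * (1 - q) ^+ m) ^+ 2.
Proof.
move=> k0 m0; have n0 : (0 < n)%N by rewrite addn_gt0 k0.
have := stirling_ratioD k0 m0; rewrite -/n /stirling_ratio.
have kp : 0 < k%:R :> rat by rewrite ltr0n.
have mp : 0 < m%:R :> rat by rewrite ltr0n.
have np : 0 < n%:R :> rat by rewrite ltr0n.
have -> : 1 - q = m%:R / n%:R.
  by rewrite /q /n natrD; field; rewrite -natrD gt_eqF.
have F : n`!%:R = 'C(n, k)%:R * k`!%:R * m`!%:R :> rat.
  by rewrite -!natrM -(@bin_fact n k) ?leq_addr // mulnA /n addKn.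
have kf : 0 < k`!%:R :> rat by rewrite ltr0n fact_gt0.
have mf : 0 < m`!%:R :> rat by rewrite ltr0n fact_gt0.
have knm : n%:R = k%:R + m%:R :> rat by rewrite -natrD.
have sq (x : rat) i : x ^+ i.*2.+1 = (x ^+ i) ^+ 2 * x.
  by rewrite exprSr -muln2 exprM.
have := exprn_gt0 k kp; have := exprn_gt0 m mp.
have := exprn_gt0 k np; have := exprn_gt0 m np.
rewrite F !sq !expr_div_n {1}/n exprD.
move: (k`!%:R : rat) (m`!%:R : rat) kf mf ('C(n, k)%:R : rat) => f g f0 g0 b.
move: (k%:R ^+ k) (m%:R ^+ m) (n%:R ^+ k) (n%:R ^+ m) => K M N1 N2.
move: (k%:R : rat) (m%:R : rat) (n%:R : rat) kp mp np knm => k' m' n' kp mp np knm.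
move=> N20 N10 M0 K0 h.
have d0 : 0 < K ^+ 2 * k' * (M ^+ 2 * m') / (f * g) ^+ 2.
  by rewrite divr_gt0 ?mulr_gt0 ?exprn_gt0 // mulr_gt0.
have := ler_wpM2r (ltW d0) h.
set X := (X in X <= _ -> _); have -> : X = 1.
  by rewrite /X; field; rewrite !gt_eqF.
set Y := (Y in _ <= Y -> _).
set Z := (Z in _ -> _ <= Z); suff -> : Z = Y * (n' / m').
  move=> Y1; apply: (le_trans Y1); rewrite -[leLHS]mulr1 ler_wpM2l //.
    exact: le_trans Y1.
  by rewrite ler_pdivlMr // mul1r knm lerDr ltW.
by rewrite /Z /Y; field; rewrite !gt_eqF.
Qed.

(** * Fourier majorant of the Bernoulli generating polynomial *)

(** With [N] larger than all degrees this is the usual scalar product; [N] is kept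
    as a parameter because it is also the order of the group of roots of unity. *)
Definition coef_dot N (p q : {poly rat}) : rat := \sum_(u < N) p`_u * q`_u.

Local Notation toC := (map_poly (ratr : rat -> algC)).

(** Orthogonality of the characters of the integers modulo [N]. *)
Lemma sum_prim_root_expr N (z : algC) u v : N.-primitive_root z ->
  (u < N)%N -> (v < N)%N ->
  \sum_(t < N) (z ^+ t) ^+ u * ((z ^+ t) ^+ v)^* = N%:R *+ (u == v).
Proof.
move=> zP uN vN.
have z1 : `|z| = 1.
  apply: (@pexpIrn _ N); rewrite ?nnegrE //; first exact: prim_order_gt0 zP.
  by rewrite -normrX (prim_expr_order zP) normr1 expr1n.
pose y := z ^+ u * (z ^+ v)^*.
have -> : \sum_(t < N) (z ^+ t) ^+ u * ((z ^+ t) ^+ v)^* = \sum_(t < N) y ^+ t.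
  by apply: eq_bigr => t _; rewrite /y exprMn !rmorphXn /= -!exprM mulnC (mulnC t v).
have yz : z ^+ u = y * z ^+ v.
  by rewrite /y -mulrA [_^* * _]mulrC -normCK normrX z1 expr1n expr1n mulr1.
have [uv|uv] := eqVneq u v.
  have -> : y = 1 by rewrite /y uv -normCK normrX z1 !expr1n.
  by under eq_bigr do rewrite expr1n; rewrite sumr_const card_ord.
have y1 : y - 1 != 0.
  apply: contra uv; rewrite subr_eq0 => /eqP y1.
  have := eq_prim_root_expr zP u v; rewrite yz y1 mul1r eqxx => /esym.
  by rewrite !modn_small.
apply: (mulfI y1); rewrite -subrX1 mulr0.
rewrite /y exprMn -rmorphXn /= -!exprM !(mulnC _ N) !exprM (prim_expr_order zP).
by rewrite !expr1n rmorph1 mulr1 subrr.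
Qed.

Lemma parseval_poly N (z : algC) (p q : {poly rat}) : N.-primitive_root z ->
  (size p <= N)%N -> (size q <= N)%N ->
  \sum_(t < N) (toC p).[z ^+ t] * ((toC q).[z ^+ t])^*
    = N%:R * ratr (coef_dot N p q).
Proof.
move=> zP sp sq.
have E (r : {poly rat}) w : (size r <= N)%N ->
    (toC r).[w] = \sum_(u < N) ratr r`_u * w ^+ u.
  move=> sr; rewrite (@horner_coef_wide _ N) ?size_map_poly //.
  by apply: eq_bigr => u _; rewrite coef_map.
under eq_bigr => t _ do rewrite !E // rmorph_sum /= mulr_suml.
rewrite exchange_big /= rmorph_sum /= mulr_sumr; apply: eq_bigr => u _.
under eq_bigr => t _ do rewrite mulr_sumr.
rewrite exchange_big /=.
have H (v : 'I_N) : \sum_(t < N) ratr p`_u * (z ^+ t) ^+ u *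
    (ratr q`_v * (z ^+ t) ^+ v)^* = ratr p`_u * ratr q`_v * (N%:R *+ (u == v)).
  rewrite -(sum_prim_root_expr zP (ltn_ord u) (ltn_ord v)) mulr_sumr.
  by apply: eq_bigr => t _; rewrite rmorphM /= fmorph_rat; ring.
rewrite (eq_bigr _ (fun v _ => H v)) (bigD1 u) //= big1 ?addr0 => [|v vu].
  by rewrite eqxx mulrC rmorphM.
by rewrite eq_sym (negbTE vu) mulr0n mulr0.
Qed.

Lemma sqr_norm_bernoulli (q : rat) (v : algC) : `|v| = 1 ->
  `|1 - ratr q + ratr q * v| ^+ 2
    = 1 - ratr (q * (1 - q)) *+ 2 + ratr (q * (1 - q)) * (v + v^*).
Proof.
move=> v1; have vv : v * v^* = 1 by rewrite -normCK v1 expr1n.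
have cc : (ratr q : algC)^* = ratr q by exact: fmorph_rat.
have -> : ratr (q * (1 - q)) = ratr q * (1 - ratr q) :> algC.
  by rewrite rmorphM rmorphB rmorph1.
move: (ratr q : algC) cc => c cc.
rewrite normCK rmorphD rmorphB rmorph1 rmorphM /= cc; move: (v^*) vv => w vw.
rewrite (_ : _ * _ = (1 - c) ^+ 2 + (1 - c) * c * (v + w) + c ^+ 2 * (v * w)).
  by rewrite vw; ring.
ring.
Qed.

Lemma rmorphMn_pow2 (A B : rat) m T c1 c2 :
  ratr (A ^+ m * B ^+ T *+ c1 *+ c2) =
  ratr A ^+ m * ratr B ^+ T *+ c1 *+ c2 :> algC.
Proof. by rewrite !raddfMn /= rmorphM !rmorphXn. Qed.

Section Majorant.
Variables (I : finType) (a : I -> nat) (D : {set I}) (h : nat) (q : rat).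
Hypotheses (cD : #|D| = h.*2) (h0 : (0 < h)%N).

Let G : {poly rat} := \sum_(i in D) 'X^(a i).
Let F : {poly rat} := \prod_(i in D) ((1 - q)%:P + q%:P * 'X^(a i)).
Let d := q * (1 - q).

(** Each factor has squared norm [1 - 2d + d (w^a + conj (w^a))]; the geometric
    mean of these [2h] squares is at most their arithmetic mean. *)
Lemma norm_bernoulli_prod_le (w : algC) : `|w| = 1 ->
  `|(toC F).[w]| <=
  (1 - ratr d *+ 2 + ratr (d / h.*2%:R) * ((toC G).[w] + (toC G).[w]^*)) ^+ h.
Proof.
move=> w1.
have wi i : `|w ^+ a i| = 1 by rewrite normrX w1 expr1n.
have n0 : h.*2%:R != 0 :> algC by rewrite pnatr_eq0 double_eq0 -lt0n.
pose E i : algC := `|1 - ratr q + ratr q * w ^+ a i| ^+ 2.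
have EF : `|(toC F).[w]| ^+ 2 = \prod_(i in D) E i.
  rewrite /F rmorph_prod horner_prod normr_prod -prodrXl; apply: eq_bigr => i _.
  rewrite /E rmorphD rmorphM /= !map_polyC map_polyXn /= hornerD hornerM !hornerC.
  by rewrite hornerXn rmorphB rmorph1.
have EG : (\sum_(i in D) E i) / h.*2%:R
   = 1 - ratr d *+ 2 + ratr (d / h.*2%:R) * ((toC G).[w] + (toC G).[w]^*).
  rewrite (eq_bigr _ (fun i _ => sqr_norm_bernoulli q (wi i))).
  rewrite big_split /= sumr_const cD -mulr_sumr big_split /=.
  have -> : (toC G).[w] = \sum_(i in D) w ^+ a i.
    rewrite /G rmorph_sum horner_sum; apply: eq_bigr => i _.
    by rewrite /= map_polyXn hornerXn.
  rewrite -rmorph_sum mulrDl -[X in X / _]mulr_natr mulfK //; congr (_ + _).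
  rewrite /d (rmorphM _ (q * _)) /= fmorphV /= ratr_nat; ring.
have E0 : 0 <= (\sum_(i in D) E i) / h.*2%:R.
  by rewrite divr_ge0 ?ler0n // sumr_ge0 // => i _; rewrite exprn_ge0.
rewrite -EG -(@ler_pXn2r _ 2) ?nnegrE ?exprn_ge0 // EF -exprM muln2 -cD.
by have [] := @leif_AGM algC I D E (fun i _ => exprn_ge0 2 (normr_ge0 _)).
Qed.

(** A coefficient is at most the mean of the norm over the [N]-th roots of unity.
    Expand the majorant of the norm twice: [T] counts the moves of the walk and
    [j] its negative moves; by Parseval each term is a scalar product. *)
Lemma coef_bernoulli_prod_le x N :
  (size F <= N)%N -> (x < N)%N ->
  (forall j, (j <= h)%N -> (size (G ^+ j) <= N)%N) ->
  F`_x <= \sum_(T < h.+1) \sum_(j < T.+1)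
     (1 - d *+ 2) ^+ (h - T) * (d / h.*2%:R) ^+ T
       * coef_dot N (G ^+ (T - j)) (G ^+ j) *+ 'C(T, j) *+ 'C(h, T).
Proof.
move=> sF xN sG.
have N0 : (0 < N)%N by apply: leq_ltn_trans xN.
have [z zP] := C_prim_root_exists N0.
have z1 : `|z| = 1.
  apply: (@pexpIrn _ N); rewrite ?nnegrE //.
  by rewrite -normrX (prim_expr_order zP) normr1 expr1n.
have Np : 0 < N%:R :> algC by rewrite ltr0n.
rewrite -(ler_rat algC) -(ler_pM2l Np).
have EF : N%:R * ratr F`_x =
    \sum_(t < N) (toC F).[z ^+ t] * ((z ^+ t) ^+ x)^* :> algC.
  have -> : F`_x = coef_dot N F 'X^x.
    rewrite /coef_dot (bigD1 (Ordinal xN)) //= coefXn eqxx mulr1 big1 ?addr0 //.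
    by move=> u ux; rewrite coefXn (_ : (u == x :> nat) = false) ?mulr0 //; apply: negbTE.
  rewrite -(parseval_poly zP) ?size_polyXn //.
  by apply: eq_bigr => t _; rewrite map_polyXn hornerXn.
have Fr : N%:R * ratr F`_x \is @Num.real algC.
  by rewrite rpredM ?realn // realE ler0q lerq0 -realE num_real.
apply: le_trans (real_ler_norm Fr) _; rewrite EF.
apply: le_trans (ler_norm_sum _ _ _) _.
pose g t := (toC G).[z ^+ t].
apply: (@le_trans _ _ (\sum_(t < N)
  (1 - ratr d *+ 2 + ratr (d / h.*2%:R) * (g t + (g t)^*)) ^+ h)).
  apply: ler_sum => t _.
  have zt : `|z ^+ t| = 1 by rewrite normrX z1 expr1n.
  rewrite normrM norm_conjC normrX zt expr1n mulr1.
  exact: norm_bernoulli_prod_le.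
have -> : \sum_(t < N) (1 - ratr d *+ 2 + ratr (d / h.*2%:R) * (g t + (g t)^*)) ^+ h
  = \sum_(t < N) \sum_(T < h.+1) \sum_(j < T.+1)
     ratr ((1 - d *+ 2) ^+ (h - T) * (d / h.*2%:R) ^+ T *+ 'C(T, j) *+ 'C(h, T))
     * (g t ^+ (T - j) * (g t ^+ j)^*).
  apply: eq_bigr => t _; rewrite exprDn; apply: eq_bigr => T _.
  rewrite exprMn (exprDn (g t)) mulrA mulr_sumr -sumrMnl; apply: eq_bigr => j _.
  rewrite !rmorphMn_pow2 rmorphXn /=.
  have -> : ratr (1 - d *+ 2) = 1 - ratr d *+ 2 :> algC by rewrite rmorphB rmorph1 raddfMn.
  by rewrite !mulrnAl mulrnAr mulrA.
rewrite exchange_big /= rmorph_sum mulr_sumr; apply: ler_sum => T _.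
rewrite exchange_big /= rmorph_sum mulr_sumr; apply: ler_sum => j _.
rewrite -mulr_sumr.
have -> : \sum_(t < N) g t ^+ (T - j) * (g t ^+ j)^* =
    N%:R * ratr (coef_dot N (G ^+ (T - j)) (G ^+ j)).
  have jT : (j <= T)%N by rewrite -ltnS.
  have Th : (T <= h)%N by rewrite -ltnS.
  rewrite -(parseval_poly zP); last 2 first.
  - by apply: sG; rewrite (leq_trans _ Th) // leq_subr.
  - by apply: sG; rewrite (leq_trans jT).
  by apply: eq_bigr => t _; rewrite !rmorphXn /= !horner_exp rmorphXn.
rewrite mulrCA -rmorphM /= -!mulrnAl lexx //.
Qed.
End Majorant.

(** * Return probability of the majorizing walk *)

Lemma mulXn_sum_coef (I : finType) (a : I -> nat) (D : {set I}) (p : {poly rat}) u :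
  ((\sum_(i in D) 'X^(a i)) * p)`_u
    = \sum_(i in D) (if (u < a i)%N then 0 else p`_(u - a i)).
Proof.
by rewrite mulr_suml coef_sum; apply: eq_bigr => i _; rewrite coefXnM.
Qed.

Section SpreadCoef.
Variables (I : finType) (a : I -> nat) (D : {set I}) (h M A : nat).
Hypotheses (aM : forall i, (M <= a i <= M + A)%N) (hA : (h * A < M)%N).
Let G : {poly rat} := \sum_(i in D) 'X^(a i).

Lemma coef_spread_pow_supp j u :
  (G ^+ j)`_u != 0 -> (j * M <= u <= j * (M + A))%N.
Proof.
elim: j u => [|j IH] u.
  by rewrite expr0 coef1; case: u => //=; rewrite eqxx.
rewrite exprS mulXn_sum_coef => nz.
have [i iD] : exists2 i, i \in D & (if (u < a i)%N then 0 else (G ^+ j)`_(u - a i)) != 0.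
  apply/exists_inP; apply: contraNT nz => /exists_inPn nz.
  by rewrite big1 // => i /nz; rewrite negbK => /eqP.
by case: ltnP; rewrite ?eqxx // => ua /IH; have := aM i; lia.
Qed.

(** The sums of [i] terms lie in [[iM, iM + iA]], and these intervals are disjoint
    for [i <= h] since [hA < M]. *)
Lemma coef_dot_spread_pow0 N i j : (i <= h)%N -> (j <= h)%N -> i != j ->
  coef_dot N (G ^+ i) (G ^+ j) = 0.
Proof.
wlog ij : i j / (i < j)%N => [W ih jh ij|].
  case: (ltngtP i j) ij => // ij _; first by rewrite W // neq_ltn ij.
  rewrite -(W j i) //; last by rewrite neq_ltn ij.
  by rewrite /coef_dot; apply: eq_bigr => u _; rewrite mulrC.
move=> ih jh _; rewrite /coef_dot big1 // => u _.
have [->|/coef_spread_pow_supp hi] := eqVneq (G ^+ i)`_u 0; first by rewrite mul0r.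
have [->|/coef_spread_pow_supp hj] := eqVneq (G ^+ j)`_u 0; first by rewrite mulr0.
exfalso; have : (i * A <= h * A)%N by rewrite leq_mul2r ih orbT.
have : (i.+1 * M <= j * M)%N by rewrite leq_mul2r ij orbT.
rewrite mulSn; move: hi hj; rewrite mulnDr; lia.
Qed.

Lemma sumset_pow_ge0 j u : 0 <= (G ^+ j)`_u.
Proof.
elim: j u => [|j IH] u; first by rewrite expr0 coef1 ler0n.
by rewrite exprS mulXn_sum_coef sumr_ge0 // => i _; case: ifP.
Qed.

(** The squares of the coefficients are summed by bounding one of the two factors by
    the largest atom. *)
Lemma coef_dot_pow_le N i : injective a -> #|D| = h.*2 ->
  (size (G ^+ i.+1) <= N)%N ->
  coef_dot N (G ^+ i.+1) (G ^+ i.+1)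
    <= ('C(i.+1, i.+1./2) * h ^ i * h.*2 ^ i.+1)%:R.
Proof.
move=> inja cD sN.
apply: (@le_trans _ _ (\sum_(u < N) ('C(i.+1, i.+1./2) * h ^ i)%:R * (G ^+ i.+1)`_u)).
  apply: ler_sum => u _; apply: ler_wpM2r; first exact: sumset_pow_ge0.
  exact: coef_sumset_pow_le.
rewrite -mulr_sumr [leRHS]natrM ler_wpM2l ?ler0n // le_eqVlt; apply/orP; left; apply/eqP.
transitivity ((G ^+ i.+1).[1]).
  rewrite (horner_coef_wide _ sN); apply: eq_bigr => u _; by rewrite expr1n mulr1.
rewrite horner_exp horner_sum.
by under eq_bigr do rewrite hornerXn expr1n; rewrite sumr_const cD natrX.
Qed.

(** Divided by [(2h)^T 2^T], the left side is the probability that [T] moves lead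
    back to the origin.  Only [j = T / 2] contributes. *)
Lemma coef_dot_binomial_sum_le N T : injective a -> #|D| = h.*2 -> (0 < h)%N ->
  (forall j, (j <= h)%N -> (size (G ^+ j) <= N)%N) -> (0 < T <= h)%N ->
  \sum_(j < T.+1) coef_dot N (G ^+ (T - j)) (G ^+ j) *+ 'C(T, j)
   <= h.*2%:R ^+ T * 2 ^+ T * (2 / h%:R) / T.+1%:R.
Proof.
move=> inja cD h0 sN /andP[T0 Th].
have hp : 0 < h%:R :> rat by rewrite ltr0n.
have rhs0 : 0 <= h.*2%:R ^+ T * 2 ^+ T * (2 / h%:R) / T.+1%:R :> rat.
  by rewrite !(mulr_ge0, exprn_ge0, divr_ge0) ?invr_ge0 ?ler0n.
have [Todd|Tev] := boolP (odd T).
  rewrite big1 // => j _; rewrite coef_dot_spread_pow0 ?mul0rn //; try by have := ltn_ord j; lia.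
have ET : T = T./2.*2 by rewrite -[LHS]odd_double_half (negbTE Tev).
have hT : (T./2 < T.+1)%N by lia.
rewrite (bigD1 (Ordinal hT)) //= [X in _ + X]big1 ?addr0; last first.
  move=> j /eqP jT; rewrite coef_dot_spread_pow0 ?mul0rn //; try by have := ltn_ord j; lia.
  by apply/eqP => e; apply: jT; apply: val_inj => /=; have := ltn_ord j; lia.
have -> : (T - T./2 = T./2)%N by lia.
move: ET T0 Th; case: (T./2) => [|i]; first by move=> ->.
move=> {hT rhs0 Tev} -> _ ih.
have := coef_dot_pow_le inja cD (sN i.+1 ltac:(lia)).
move: (coef_dot _ _ _) => c hc.
apply: (@le_trans _ _ (('C(i.+1, i.+1./2) * h ^ i * h.*2 ^ i.+1)%:R *+ 'C(i.+1.*2, i.+1))).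
  by rewrite lerMn2r hc orbT.
have h1 : (0 < i.+1.*2.+1%:R :> rat) by rewrite ltr0n.
rewrite ler_pdivlMr // mulrA ler_pdivlMr // -mulrnA -!natrX -!natrM ler_nat.
have := bin_central_mul i.+1.
move: ('C(i.+1, _)) ('C(i.+1.*2, _)) => c1 c2 hb.
have -> : (h.*2 ^ i.+1.*2 * 2 ^ i.+1.*2 * 2 = 8 ^ i.+1 * 2 * (h.*2 ^ i.+1 * h ^ i.+1))%N.
  rewrite -[i.+1.*2]addnn !expnD -[8%N]/(2 * (2 * 2))%N !expnMn -muln2 !expnMn; ring.
have -> : (c1 * h ^ i * h.*2 ^ i.+1 * c2 * i.+1.*2.+1 * h =
  c2 * c1 * i.+1.*2.+1 * (h.*2 ^ i.+1 * h ^ i.+1))%N by rewrite (expnS h i); ring.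
rewrite leq_mul2r; apply/orP; right.
apply: (@leq_trans (c2 * c1 * i.+2 * 2)); last by rewrite leq_mul2r hb orbT.
by rewrite -[leqRHS]mulnA leq_mul2l; apply/orP; right; lia.
Qed.
End SpreadCoef.

Lemma coef_dot11 N : coef_dot N.+1 1 1 = 1.
Proof.
rewrite /coef_dot big_ord_recl big1 ?addr0 => [|u _]; first by rewrite coef1 mulr1.
by rewrite coef1 mul0r.
Qed.

Section UpperBound.
Variables (I : finType) (a : I -> nat) (D : {set I}) (h M A : nat) (q : rat).
Hypotheses (aM : forall i, (M <= a i <= M + A)%N) (hA : (h * A < M)%N).
Hypotheses (inja : injective a) (cD : #|D| = h.*2) (h0 : (0 < h)%N).
Hypothesis (q01 : 0 < q <= 1 / 2).
Let d := q * (1 - q).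

Lemma coef_bernoulli_prod_le_spread x :
  (\prod_(i in D) ((1 - q)%:P + q%:P * 'X^(a i)) : {poly rat})`_x
   <= (1 - d *+ 2) ^+ h + 2 / h%:R / (h.+1%:R * (d *+ 2)).
Proof.
have /andP[q0 q1] := q01.
set F := (F in F`_x); pose G : {poly rat} := \sum_(i in D) 'X^(a i).
(* Any N above all degrees in play serves. *)
pose N := (size F + x + \sum_(j < h.+1) size (G ^+ j)).+1.
have sG j : (j <= h)%N -> (size (G ^+ j) <= N)%N.
  move=> jh; have jh' : (j < h.+1)%N by [].
  by rewrite /N (bigD1 (Ordinal jh')) //=; lia.
have dp : 0 < d *+ 2 <= 1.
  by rewrite /d; apply/andP; split; nra.
have hp : 0 < h%:R :> rat by rewrite ltr0n.
apply: le_trans (@coef_bernoulli_prod_le I a D h q cD h0 x N _ _ sG) _.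
- by rewrite leqW // -addnA leq_addr.
- by rewrite ltnS addnAC leq_addl.
rewrite -/d -/G big_ord_recl; apply: lerD.
  rewrite big_ord1 subn0 !expr0 !bin0 !mulr1n mulr1.
  by rewrite coef_dot11 mulr1.
have /andP[dp0 dp1] := dp.
apply: (@le_trans _ _ (2 / h%:R * \sum_(T < h.+1)
   (1 - d *+ 2) ^+ (h - T) * (d *+ 2) ^+ T *+ 'C(h, T) / T.+1%:R)); last first.
  by apply: ler_wpM2l; [rewrite divr_ge0 // ltW | exact: inverse_moment].
rewrite big_ord_recl mulrDr; apply: ler_wpDl.
  apply: mulr_ge0; first by rewrite divr_ge0 // ltW.
  rewrite divr_ge0 ?ler0n // mulrn_wge0 // mulr_ge0 // exprn_ge0 ?subr_ge0 //.
rewrite mulr_sumr; apply: ler_sum => T _.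
rewrite lift0; have T1 : (0 < T.+1 <= h)%N by rewrite ltn_ord.
have B := coef_dot_binomial_sum_le aM hA inja cD h0 sG T1.
have np : h.*2%:R != 0 :> rat by rewrite pnatr_eq0 double_eq0 -lt0n.
pose w : rat := (1 - d *+ 2) ^+ (h - T.+1) * (d / h.*2%:R) ^+ T.+1 *+ 'C(h, T.+1).
have w0 : 0 <= w.
  rewrite mulrn_wge0 // mulr_ge0 // exprn_ge0 ?subr_ge0 //.
  by rewrite divr_ge0 ?ler0n //; lra.
have := ler_wpM2l w0 B; rewrite mulr_sumr => {}B.
have e1 : \sum_(j < T.+2) (1 - d *+ 2) ^+ (h - T.+1) * (d / h.*2%:R) ^+ T.+1 *
    coef_dot N (G ^+ (T.+1 - j)) (G ^+ j) *+ 'C(T.+1, j) *+ 'C(h, T.+1) =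
    \sum_(j < T.+2) w * (coef_dot N (G ^+ (T.+1 - j)) (G ^+ j) *+ 'C(T.+1, j)).
  by apply: eq_bigr => j _; rewrite /w mulrnAl mulrnAr.
rewrite e1; apply: le_trans B _; rewrite le_eqVlt; apply/orP; left; apply/eqP.
rewrite /w expr_div_n -[d *+ 2]mulr_natr [(d * 2) ^+ _]exprMn -!(mulr_natr (_ * _)).
have := expf_neq0 T.+1 np; move: (h.*2%:R ^+ T.+1) (d ^+ T.+1) (2 ^+ T.+1) => b c e b0.
move: ((_ - _) ^+ _) ('C(h, T.+1)%:R) => f g.
by field; rewrite b0 -(natrD _ 2 T) !pnatr_eq0 -!lt0n h0.
Qed.
End UpperBound.

(** * Families of subsets with prescribed size and sum *)

Definition sum_family (I : finType) (V : nmodType) (a : I -> V) (D : {set I})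
    (k : nat) (x : V) : {set {set I}} :=
  [set B : {set I} | [&& B \subset D, #|B| == k & \sum_(i in B) a i == x]].

Section NatFamilies.
Variables (I : finType) (a : I -> nat) (D : {set I}).

(** The left sum uses the algebraic structure on [nat], the right one is [addn]
    iterated. *)
Lemma sum_natE (B : {set I}) : \sum_(i in B) a i = (\sum_(i in B) a i)%N.
Proof. by []. Qed.

(** Count the pairs of a set of the family and one of its elements, and remove that
    element. *)
Lemma sum_family_removal k (x : nat) :
  (k.+1 * #|sum_family a D k.+1 x| <=
   \sum_(i in D) (if (x < a i)%N then 0 else #|sum_family a D k (x - a i)%N|))%N.
Proof.
have -> : (k.+1 * #|sum_family a D k.+1 x|)%N =
   (\sum_(i in D) #|[set B in sum_family a D k.+1 x | i \in B]|)%N.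
  rewrite mulnC -sum_nat_const.
  transitivity (\sum_(B in sum_family a D k.+1 x) \sum_(i in D) (i \in B : nat))%N.
    apply: eq_bigr => B; rewrite inE => /and3P[BD /eqP <- _].
    rewrite -big_mkcondr -sum1_card; apply: eq_bigl => i.
    by case: (boolP (i \in B)) => [/(subsetP BD)->|]; rewrite ?andbF.
  rewrite exchange_big /=; apply: eq_bigr => i _.
  by rewrite -big_mkcondr -sum1_card; apply: eq_bigl => B; rewrite inE.
apply: leq_sum => i iD.
have sumD1 (B : {set I}) : i \in B ->
    (\sum_(j in B) a j = a i + \sum_(j in B :\ i) a j)%N.
  by move=> iB; rewrite (big_setD1 i iB).
case: ltnP => xi.
  rewrite leqn0 cards_eq0; apply/eqP/setP => B; rewrite !inE.
  apply/negP => /andP[/and3P[_ _ /eqP]]; rewrite sum_natE => sB iB.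
  by move: xi; rewrite -sB sumD1 //; lia.
have inj : {in [set B in sum_family a D k.+1 x | i \in B] &,
    injective (fun B : {set I} => B :\ i)}.
  move=> B B'; rewrite !inE => /andP[_ iB] /andP[_ iB'] e.
  by rewrite -(setD1K iB) -(setD1K iB') e.
rewrite -(card_in_imset inj); apply/subset_leq_card/subsetP => _ /imsetP[B BF ->].
move: BF; rewrite !inE => /andP[/and3P[BD /eqP cB /eqP sB] iB].
apply/and3P; split.
- by apply: subset_trans BD; apply: subsetDl.
- by move: cB; rewrite (cardsD1 i) iB add1n => -[->].
- by move: sB; rewrite !sum_natE => <-; rewrite (sumD1 B) // addKn.
Qed.

(** Each set of [k] elements is enumerated by [k!] tuples with the same sum. *)
Lemma sum_family_fact_le k (x : nat) :
  (#|sum_family a D k x| * k`!)%:R <=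
    ((\sum_(i in D) 'X^(a i)) ^+ k : {poly rat})`_x.
Proof.
elim: k x => [|k IH] x.
  rewrite expr0 coef1 fact0 muln1 ler_nat.
  apply: (@leq_trans #|[set set0 : {set I}] :&: [set B | x == 0%N]|).
    apply/subset_leq_card/subsetP => B; rewrite !inE cards_eq0.
    by case/and3P=> _ /eqP-> /eqP<-; rewrite big_set0 !eqxx.
  case: eqP => _; first by rewrite (leq_trans (subset_leq_card (subsetIl _ _))) ?cards1.
  rewrite (_ : _ :&: _ = set0) ?cards0 //.
  by apply/setP => B; rewrite !inE andbF.
rewrite exprS mulXn_sum_coef.
apply: (@le_trans _ _ (\sum_(i in D) (if (x < a i)%N then 0 else #|sum_family a D k (x - a i)%N| * k`!)%:R)).
  rewrite -natr_sum ler_nat factS mulnA [(_ * k.+1)%N]mulnC.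
  apply: leq_trans (leq_mul (sum_family_removal k x) (leqnn k`!)) _.
  rewrite big_distrl /=; apply: leq_sum => i _; by case: ifP.
by apply: ler_sum => i _; case: ifP.
Qed.

(** In the expansion of the product, the sets of the family contribute the left
    side, and all other sets contribute nonnegative terms. *)
Lemma coef_bernoulli_prod_ge k (x : nat) (q : rat) : 0 <= q <= 1 ->
  #|sum_family a D k x|%:R * (q ^+ k * (1 - q) ^+ (#|D| - k)) <=
  (\prod_(i in D) ((1 - q)%:P + q%:P * 'X^(a i)) : {poly rat})`_x.
Proof.
move=> /andP[q0 q1].
pose f i : {poly rat} := if i \in D then q%:P * 'X^(a i) else 0.
pose g i : {poly rat} := if i \in D then (1 - q)%:P else 1.
have -> : \prod_(i in D) ((1 - q)%:P + q%:P * 'X^(a i)) = \prod_i (f i + g i).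
  rewrite big_mkcond; apply: eq_bigr => i _; rewrite /f /g.
  by case: ifP => _; rewrite ?add0r // addrC.
rewrite bigA_distr coef_sum.
have T0 (J : {set I}) : ~~ (J \subset D) ->
    \prod_i (if i \in J then f i else g i) = 0.
  case/subsetPn => i iJ iD.
  by rewrite (bigD1 i) //= iJ /f (negbTE iD) mul0r.
have T1 (J : {set I}) : J \subset D ->
    \prod_i (if i \in J then f i else g i) =
    (q ^+ #|J| * (1 - q) ^+ (#|D| - #|J|)) *: 'X^(\sum_(i in J) a i)%N.
  move=> JD; rewrite (bigID (mem J)) /=.
  rewrite (eq_bigr (fun i => q%:P * 'X^(a i))) => [|i iJ]; last first.
    by rewrite iJ /f (subsetP JD _ iJ).
  rewrite [X in _ * X](eq_bigr g) => [|i iJ]; last by rewrite (negbTE iJ).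
  rewrite big_split /= prodr_const expr_sum /g -big_mkcondr /=.
  rewrite [X in _ * X](eq_bigl (fun i => i \in D :\: J)) => [|i]; last by rewrite in_setD.
  rewrite prodr_const cardsD (setIidPr JD) -!rmorphXn /= mulrAC -polyCM.
  by rewrite mul_polyC.
rewrite (bigID (mem (sum_family a D k x))) /=; apply: ler_wpDr.
  apply: sumr_ge0 => J _; have [JD|/T0->] := boolP (J \subset D); last by rewrite coef0.
  by rewrite T1 // coefZ coefXn mulr_ge0 ?ler0n // mulr_ge0 ?exprn_ge0 // subr_ge0.
rewrite (eq_bigr (fun=> q ^+ k * (1 - q) ^+ (#|D| - k))).
  by rewrite sumr_const -[leRHS]mulr_natl lexx.
move=> J; rewrite inE => /and3P[JD /eqP cJ /eqP sJ].
by rewrite T1 // coefZ coefXn -sum_natE sJ eqxx mulr1 cJ.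
Qed.
End NatFamilies.

(** * Subsets of even-sized sets of integers *)

(** A union bound over the coincidences among [k] draws from [n] objects, multiplied
    by [n^(k+1)]. *)
Lemma expn_le_falling n k : (n ^ k * n <= n ^_ k * n + k ^ 2 * n ^ k)%N.
Proof.
elim: k => [|k IH]; first by rewrite ffactn0 leq_addr.
rewrite ffactnSr expnSr.
have le_ff : (n ^_ k <= n ^ k)%N.
  elim: k {IH} => // k IH; rewrite ffactnSr expnSr leq_mul ?leq_subr //.
have := leq_mul IH (leqnn n); move: le_ff; move: (n ^_ k) (n ^ k)%N => u v uv h.
have : (u * n <= u * (n - k) + v * k)%N.
  apply: (@leq_trans (u * (n - k) + u * k)%N); last by rewrite leq_add2l leq_mul2r uv orbT.
  by rewrite -mulnDr leq_mul2l; apply/orP; right; lia.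
move/leq_mul/(_ (leqnn n)); move: (n - k)%N => r h2.
apply: leq_trans h _; rewrite mulnDl; apply: leq_trans (leq_add h2 (leqnn _)) _.
nia.
Qed.

(** Since [(1 - q) (1 + q) <= 1], it suffices to bound [(1 + q)^h] from below, and
    its expansion contains a term of order [(hq)^3 = (k/2)^3]. *)
Lemma exp_negligible h k : (0 < k <= h)%N ->
  (1 - k%:R / h.*2%:R) ^+ h <= 128 / k%:R ^+ 3 :> rat.
Proof.
move=> /andP[k0 kh].
have kp : 1 <= k%:R :> rat by rewrite ler1n.
have hp : k%:R <= h%:R :> rat by rewrite ler_nat.
set q := k%:R / _.
have qE : q = k%:R / h%:R / 2 by rewrite /q -muln2 natrM; field; lra.
have q0 : 0 <= q by rewrite divr_ge0 ?ler0n.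
have q1 : q <= 1 / 2.
  have : k%:R / h%:R <= 1 :> rat by rewrite ler_pdivrMr ?mul1r //; lra.
  by rewrite qE; lra.
have low : k%:R ^+ 3 / 128 <= (1 + q) ^+ h.
  apply: le_trans (bernoulli3 h q0).
  have hq : h%:R * q = k%:R / 2 by rewrite qE; field; lra.
    (* For h <= 3 also k <= 3, and k^3 <= 27 < 128. *)
  have [h3|h4] := leqP h 3.
    have k3 : k%:R <= 3 :> rat by rewrite (ler_nat _ _ 3); lia.
    apply: (@le_trans _ _ 1).
      have : k%:R ^+ 3 <= 3 ^+ 3 :> rat by rewrite ler_pXn2r ?nnegrE //; lra.
      lra.
    have h1 : 0 <= h%:R * (h%:R - 1) :> rat by rewrite mulr_ge0; lra.
    have t1 : 0 <= h%:R * q by rewrite mulr_ge0 ?ler0n.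
    have t2 : 0 <= h%:R * (h%:R - 1) / 2 * q ^+ 2.
      by rewrite mulr_ge0 ?exprn_ge0 // divr_ge0.
    have t3 : 0 <= h%:R * (h%:R - 1) * (h%:R - 2) / 6 * q ^+ 3.
      by rewrite mulr_ge0 ?exprn_ge0 // divr_ge0 ?falling3_ge0.
    lra.
  have h4' : 4 <= h%:R :> rat by rewrite (ler_nat _ 4).
  have h2 : 0 <= h%:R * (h%:R - 1) :> rat by rewrite mulr_ge0; lra.
  have e3 : h%:R * (h%:R - 1) * (h%:R - 2) / 6 * q ^+ 3 =
    k%:R ^+ 3 / 48 * ((1 - h%:R^-1) * (1 - 2 / h%:R)).
    by rewrite qE; field; lra.
  have hi : h%:R^-1 <= 1 / 4 :> rat by rewrite div1r lef_pV2 ?posrE //; lra.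
  have hi0 : 0 <= h%:R^-1 :> rat by rewrite invr_ge0 ler0n.
  have : 3 / 8 <= (1 - h%:R^-1) * (1 - 2 / h%:R) :> rat by nra.
  have k3 : 0 <= k%:R ^+ 3 / 48 :> rat by rewrite divr_ge0 ?exprn_ge0 ?ler0n.
  move=> /(ler_wpM2l k3); rewrite -e3.
  have : 0 <= h%:R * (h%:R - 1) / 2 * q ^+ 2 by rewrite mulr_ge0 ?exprn_ge0 // divr_ge0.
  rewrite hq; lra.
have k3 : 0 < k%:R ^+ 3 :> rat by rewrite exprn_gt0 //; lra.
have L0 : 0 <= (1 - q) ^+ h by rewrite exprn_ge0 //; lra.
have LP : (1 - q) ^+ h * (1 + q) ^+ h <= 1.
  rewrite -exprMn (_ : (1 - q) * (1 + q) = 1 - q ^+ 2); last by ring.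
  by apply: exprn_ile1; nra.
move: (k%:R ^+ 3) ((1 - q) ^+ h) ((1 + q) ^+ h) low LP L0 k3 => K L P low LP L0 k3.
have LK := ler_wpM2l L0 low.
by rewrite ler_pdivlMr; [lra | exact: k3].
Qed.

Section EvenCase.
Variables (I : finType) (a : I -> nat) (D : {set I}) (h k x : nat).
Hypotheses (inja : injective a) (cD : #|D| = h.*2) (kh : (0 < k <= h)%N).
Let N := #|sum_family a D k x|.

(** Since [2 k^2 <= n], [k] independent draws are distinct with probability at
    least 1/2, so that the bound on the atoms of their sum loses a factor 2. *)
Lemma even_case_sparse : (k ^ 2 <= h)%N ->
  ((N * h.*2) ^ 2 * k <= 16 * 'C(h.*2, k) ^ 2)%N.
Proof.
move=> k2; have /andP[k0 kh'] := kh.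
have h0 : (0 < h)%N by lia.
have B : (N * k`! <= 'C(k, k./2) * h ^ k.-1)%N.
  rewrite -(@ler_nat rat); apply: le_trans (sum_family_fact_le a D k x) _.
  by have := @coef_sumset_pow_le I a D h k.-1 x inja cD; rewrite prednK.
have ff : (h.*2 ^ k <= 2 * h.*2 ^_ k)%N.
  have := expn_le_falling h.*2 k.
  move: (h.*2 ^ k)%N (h.*2 ^_ k) => u v e; rewrite -(@leq_pmul2r h); last by [].
  have : (k ^ 2 * u <= h * u)%N by rewrite leq_mul2r k2 orbT.
  lia.
have E : (N * h.*2 * 2 ^ k <= 4 * 'C(k, k./2) * 'C(h.*2, k))%N.
  rewrite -(@leq_pmul2r k`!) ?fact_gt0 // -[leqRHS]mulnA bin_ffact.
  apply: (@leq_trans (2 * 'C(k, k./2) * h.*2 ^ k)%N); last first.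
    apply: leq_trans (leq_mul (leqnn _) ff) _.
    suff -> : (2 * 'C(k, k./2) * (2 * h.*2 ^_ k) = 4 * 'C(k, k./2) * h.*2 ^_ k)%N by [].
    by ring.
  have -> : (N * h.*2 * 2 ^ k * k`! = N * k`! * (h.*2 * 2 ^ k))%N by ring.
  apply: leq_trans (leq_mul B (leqnn _)) _.
  rewrite -muln2 expnMn.
  have -> : (h ^ k = h * h ^ k.-1)%N by rewrite -expnS prednK.
  suff -> : ('C(k, k./2) * h ^ k.-1 * (h * 2 * 2 ^ k) =
    2 * 'C(k, k./2) * (h * h ^ k.-1 * 2 ^ k))%N by [].
  by ring.
have p4 : (0 < 4 ^ k)%N by rewrite expn_gt0.
rewrite -(leq_pmul2r p4).
have E2 := leq_mul E E; have C2 := bin_central_sq k.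
have e4 : (4 ^ k = 2 ^ k * 2 ^ k)%N by rewrite -expnMn.
apply: (@leq_trans (N * h.*2 * 2 ^ k * (N * h.*2 * 2 ^ k) * k.+1)%N).
  rewrite e4 (_ : _ * _ = N * h.*2 * 2 ^ k * (N * h.*2 * 2 ^ k) * k)%N; last by ring.
  by rewrite leq_mul2l leqnSn orbT.
apply: leq_trans (leq_mul E2 (leqnn _)) _.
rewrite (_ : _ * _ = 16 * 'C(h.*2, k) ^ 2 * ('C(k, k./2) ^ 2 * k.+1))%N; last by ring.
by rewrite leq_mul2l C2 orbT.
Qed.

(** The hypothesis [h <= k^2] is what makes the probability [(1 - 2d)^h] of no move
    at most [128 / (hk)]; the walks that move account for [4 / (hk)]. *)
Lemma even_case_mass_le (M A : nat) :
    (forall i, M <= a i <= M + A)%N -> (h * A < M)%N -> (h <= k ^ 2)%N ->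
  N%:R * ((k%:R / h.*2%:R) ^+ k * (1 - k%:R / h.*2%:R) ^+ (h.*2 - k))
    <= 132 / (h%:R * k%:R) :> rat.
Proof.
move=> aM hA hk; have /andP[k0 kh'] := kh.
have h0 : (0 < h)%N by lia.
have kp : 0 < k%:R :> rat by rewrite ltr0n.
have hp : 0 < h%:R :> rat by rewrite ltr0n.
have khp : k%:R <= h%:R :> rat by rewrite ler_nat.
have hk2 : h%:R <= k%:R ^+ 2 :> rat by rewrite -natrX ler_nat.
have en := exp_negligible kh.
set q := k%:R / _ in en *.
have qE : q = k%:R / h%:R / 2 by rewrite /q -muln2 natrM; field; lra.
have q0 : 0 < q by rewrite divr_gt0 // ltr0n double_gt0.
have q1 : q <= 1 / 2.
  have : k%:R / h%:R <= 1 :> rat by rewrite ler_pdivrMr ?mul1r //; lra.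
  by rewrite qE; lra.
have q01 : 0 <= q <= 1 by rewrite ltW //=; lra.
have := coef_bernoulli_prod_ge a D k x q01; rewrite cD => lo.
apply: le_trans lo _.
have q0h : 0 < q <= 1 / 2 by rewrite q0.
apply: le_trans (coef_bernoulli_prod_le_spread aM hA inja cD h0 q0h x) _.
have dq : q <= q * (1 - q) *+ 2 by rewrite -mulr_natr; nra.
have d1 : q * (1 - q) *+ 2 <= 1 by rewrite -mulr_natr; nra.
have t1 : (1 - q * (1 - q) *+ 2) ^+ h <= 128 / (h%:R * k%:R).
  apply: (@le_trans _ _ ((1 - q) ^+ h)).
    by apply: lerXn2r; rewrite ?nnegrE; lra.
  apply: le_trans en _; apply: ler_wpM2l; first by lra.
  rewrite lef_pV2 ?posrE ?mulr_gt0 ?exprn_gt0 //.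
  by rewrite exprSr ler_wpM2r // ltW.
have t2 : 2 / h%:R / (h.+1%:R * (q * (1 - q) *+ 2)) <= 4 / (h%:R * k%:R).
  have s0 : 0 < h%:R * q by rewrite mulr_gt0.
  have s1 : h%:R * q <= h.+1%:R * (q * (1 - q) *+ 2).
    by rewrite ler_pM ?ler_nat // ltW.
  apply: (@le_trans _ _ (2 / h%:R / (h%:R * q))).
    apply: ler_wpM2l; first by rewrite divr_ge0 // ltW.
    by rewrite lef_pV2 ?posrE //; apply: lt_le_trans s1.
  rewrite qE le_eqVlt; apply/orP; left; apply/eqP; field; lra.
apply: le_trans (lerD t1 t2) _.
move: ((h%:R * k%:R)^-1) => w.
suff -> : 128 * w + 4 * w = 132 * w by exact: lexx.
by ring.
Qed.

(** Divide [even_case_mass_le] by [binomial_mode_ge].  With [n = 2h] the numerator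
    of the former is [264 = 2 * 132], and [8 * 264^2 = 32 * 132^2]. *)
Lemma even_case_dense (M A : nat) :
    (forall i, M <= a i <= M + A)%N -> (h * A < M)%N -> (h <= k ^ 2)%N ->
  ((N * h.*2) ^ 2 * k <= 32 * 132 ^ 2 * 'C(h.*2, k) ^ 2)%N.
Proof.
move=> aM hA hk; have /andP[k0 kh'] := kh.
have h0 : (0 < h)%N by lia.
have kp : 0 < k%:R :> rat by rewrite ltr0n.
have hp : 0 < h%:R :> rat by rewrite ltr0n.
have up := even_case_mass_le aM hA hk.
have m0 : (0 < h.*2 - k)%N by lia.
have := binomial_mode_ge k0 m0; rewrite subnKC; last by lia.
move: up; set P := (_ ^+ k * _ ^+ _).
rewrite -(mulrA 'C(_, _)%:R) -/P => up lo.
have P0 : 0 <= N%:R * P.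
  have q1 : k%:R / h.*2%:R <= 1 :> rat.
    rewrite ler_pdivrMr ?ltr0n ?double_gt0 // mul1r ler_nat; lia.
  by rewrite mulr_ge0 ?ler0n // mulr_ge0 ?exprn_ge0 ?divr_ge0 ?ler0n // subr_ge0.
have uv0 : 0 < h%:R * k%:R :> rat by rewrite mulr_gt0.
have {}up : N%:R * P * (h%:R * k%:R) <= 132 by rewrite -ler_pdivlMr.
have up2 : (N%:R * P * (h%:R * k%:R)) ^+ 2 <= 132 ^+ 2.
  apply: lerXn2r up; rewrite nnegrE; last exact: ler0n.
  by rewrite mulr_ge0 // ltW.
rewrite -(ler_nat rat) !(natrM, natrX) (_ : h.*2%:R = h%:R * 2); last by rewrite -muln2 natrM.
rewrite -(ler_pM2r kp).
move: (N%:R : rat) ('C(_, _)%:R : rat) (h%:R : rat) (k%:R : rat) lo up2 hp kp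
  => {up P0} n c u v lo up2 u0 v0.
apply: (@le_trans _ _ ((n * (u * 2)) ^+ 2 * v * v * (8 * v * (c * P) ^+ 2))).
  rewrite -[leLHS]mulr1.
  apply: ler_wpM2l; last exact: lo.
  have v1 := ltW v0; apply: mulr_ge0 => //; apply: mulr_ge0 => //; exact: sqr_ge0.
rewrite (_ : _ * _ = 32 * v * c ^+ 2 * (n * P * (u * v)) ^+ 2); last by ring.
have w0 : 0 <= 32 * v * c ^+ 2.
  by have v1 := ltW v0; apply: mulr_ge0; [apply: mulr_ge0 | exact: sqr_ge0].
apply: le_trans (ler_wpM2l w0 up2) _.
move: (132 ^+ 2) => b.
suff -> : 32 * v * c ^+ 2 * b = 32 * b * c ^+ 2 * v by exact: lexx.
by ring.
Qed.

Lemma even_case (M A : nat) :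
    (forall i, M <= a i <= M + A)%N -> (h * A < M)%N ->
  ((N * h.*2) ^ 2 * k <= 32 * 132 ^ 2 * 'C(h.*2, k) ^ 2)%N.
Proof.
move=> aM hA; have [kh2|/ltnW kh2] := leqP (k ^ 2) h.
  apply: leq_trans (even_case_sparse kh2) _.
  rewrite leq_mul2r; apply/orP; right; apply: (@leq_trans 32); first by [].
  by apply: leq_pmulr; rewrite expn_gt0.
exact: even_case_dense aM hA kh2.
Qed.
End EvenCase.

(** * From real numbers to integers *)

(** Dirichlet's theorem.  The fractional parts of the vectors [j a], for more values
    of [j] than there are boxes of side [1/m], put two of them in the same box;
    [q] is the difference of the two values of [j]. *)
Lemma simultaneous_approximation (R : archiRealFieldType) (I : finType)
    (a : I -> R) (m : nat) : (0 < m)%N ->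
  exists (q : nat) (p : I -> int), (0 < q)%N /\
    forall i, `|q%:R * a i - (p i)%:~R| < m%:R^-1.
Proof.
case: m => // m _.
have mp : 0 < m.+1%:R :> R by rewrite ltr0n.
pose fl j i : int := Num.floor (j%:R * a i).
pose fr (j : nat) i : R := j%:R * a i - (fl j i)%:~R.
have fr01 j i : 0 <= fr j i < 1.
  have := floor_itv (j%:R * a i).
  by rewrite /fr -/(fl j i) intrD /= => /andP[? ?]; apply/andP; split; lra.
pose cell j i := Num.trunc (m.+1%:R * fr j i).
have cellP j i : (cell j i)%:R <= m.+1%:R * fr j i < (cell j i).+1%:R.
  by apply: truncn_itv; rewrite mulr_ge0 ?ler0n //; case/andP: (fr01 j i).
have cell_lt j i : (cell j i < m.+1)%N.
  have /andP[lo _] := cellP j i; have /andP[_ f1] := fr01 j i.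
  rewrite -(ltr_nat R); apply: le_lt_trans lo _.
  by rewrite -[ltRHS]mulr1 ltr_pM2l.
pose box (j : 'I_(#|{ffun I -> 'I_m.+1}|.+1)) : {ffun I -> 'I_m.+1} :=
  [ffun i => Ordinal (cell_lt j i)].
have /injectivePn[j [j' jj' bE]] : ~~ injectiveb box.
  apply/negP => /injectiveP /leq_card; by rewrite card_ord ltnn.
wlog lt_jj' : j j' jj' bE / (j < j')%N => [W|].
  case: (ltngtP j j') => [|lt|/val_inj e]; first exact: W.
    by apply: (W j' j); rewrite // eq_sym.
  by rewrite e eqxx in jj'.
exists (j' - j)%N, (fun i => fl j' i - fl j i); split; first by rewrite subn_gt0.
move=> i; rewrite natrB ?(ltnW lt_jj') //.
have -> : (j'%:R - j%:R) * a i - (fl j' i - fl j i)%:~R = fr j' i - fr j i.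
  by rewrite /fr rmorphB /=; ring.
have cE : cell j i = cell j' i.
  by move/ffunP/(_ i): bE; rewrite !ffunE => -[].
have := cellP j i; have := cellP j' i; rewrite -cE -[(cell j i).+1%:R]natr1.
move=> /andP[l1 u1] /andP[l2 u2].
rewrite -(@ltr_pM2l _ m.+1%:R) // mulfV ?gt_eqF // -[X in X * `|_|]gtr0_norm //.
rewrite -normrM ltr_norml mulrBr; apply/andP; split; lra.
Qed.

(** Scale [a] by [c] until distinct values are at distance at least 2, multiply by
    [q] and round to the integers [p].  With errors below [1 / (2 #|I| + 1)],
    distinct values remain distinct, and equal subset sums have rounded sums at
    distance below 1, hence equal.  The shift by [M + S] makes all terms large;
    it changes sums of equally many terms by the same amount. *)
Lemma integer_model (R : archiRealFieldType) (I : finType) (a : I -> R) (h : nat) :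
  injective a ->
  exists (b : I -> nat) (M A : nat), [/\ injective b,
    forall i, (M <= b i <= M + A)%N, (h * A < M)%N &
    forall B B' : {set I}, #|B| = #|B'| ->
      \sum_(i in B) a i = \sum_(i in B') a i ->
      \sum_(i in B) b i = \sum_(i in B') b i].
Proof.
move=> inja.
pose c : R := \sum_i \sum_j 2 / `|a i - a j|.
have c_ge i j : i != j -> 2 <= c * `|a i - a j|.
  move=> ij; have d0 : 0 < `|a i - a j|.
    by rewrite normr_gt0 subr_eq0; apply: contra ij => /eqP/inja->.
  rewrite -ler_pdivrMr // /c (bigD1 i) //= (bigD1 j) //= -addrA lerDl.
  rewrite addr_ge0 // sumr_ge0 // => i' _; first by rewrite divr_ge0.
  by rewrite sumr_ge0 // => j' _; rewrite divr_ge0.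
pose m := (2 * #|I|).+1.
have mp : 0 < m%:R :> R by rewrite ltr0n.
have [q [p [q0 pP]]] := @simultaneous_approximation R I (fun i => c * a i) m isT.
have q1 : 1 <= q%:R :> R by rewrite ler1n.
have sum_close (B : {set I}) :
    `|q%:R * c * \sum_(i in B) a i - (\sum_(i in B) p i)%:~R| <= #|I|%:R / m%:R.
  rewrite rmorph_sum /= mulr_sumr -sumrB; apply: le_trans (ler_norm_sum _ _ _) _.
  apply: (@le_trans _ _ (\sum_(i in B) m%:R^-1)).
    by apply: ler_sum => i _; rewrite -mulrA ltW.
  rewrite sumr_const -[leLHS]mulr_natl; apply: ler_wpM2r.
    by rewrite invr_ge0 ltW.
  by rewrite ler_nat max_card.
have mI : #|I|%:R / m%:R + #|I|%:R / m%:R < 1 :> R.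
  rewrite -mulrDl ltr_pdivrMr // mul1r -natrD ltr_nat /m; lia.
have int0 (z : int) : `|z%:~R : R| < 1 -> z = 0.
  rewrite -intr_norm (ltr_int R _ 1); lia.
(* With 0 <= S + p i <= 2 S all shifted values lie in [M, M + 2 S]. *)
pose S := (\sum_i `|p i|)%N.
have pS i : (`|p i| <= S)%N by rewrite /S (bigD1 i) //= leq_addr.
pose M := (h * (2 * S)).+1.
pose b i : nat := absz ((M + S)%N%:Z + p i).
have bE i : (b i)%:Z = (M + S)%N%:Z + p i by rewrite /b gez0_abs //; have := pS i; lia.
exists b, M, (2 * S)%N; split=> //.
- move=> i j bij; apply/eqP/negPn/negP => ij.
  have pij : p i = p j by have := bE i; rewrite bij bE; lia.
  have := pP i; have := pP j; rewrite pij !ltr_norml => /andP[l1 u1] /andP[l2 u2].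
  have m1 : m%:R^-1 <= 1 :> R by rewrite invf_le1 // ler1n.
  have := c_ge i j ij; rewrite -[c](@ger0_norm) //; last first.
    by apply: sumr_ge0 => ? _; apply: sumr_ge0 => ? _; rewrite divr_ge0.
  rewrite -normrM mulrBr; apply/negP; rewrite -ltNge.
  have : `|q%:R * (c * a i - c * a j)| < 2 by rewrite ltr_norml; apply/andP; split; lra.
  rewrite normrM ger0_norm ?ler0n // => lt2.
  apply: le_lt_trans lt2.
  by rewrite -[leLHS]mul1r ler_wpM2r.
- by move=> i; have := pS i; have := bE i; lia.
move=> B B' cB sB.
have e : \sum_(i in B) p i = \sum_(i in B') p i.
  apply/eqP; rewrite -subr_eq0; apply/eqP/int0; rewrite rmorphB /=.
  apply: le_lt_trans mI; apply: le_trans (lerD (sum_close B') (sum_close B)).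
  rewrite sB distrC [X in _ <= X + _]distrC.
  apply: le_trans (ler_distD (q%:R * c * \sum_(i in B') a i) _ _) _.
  by rewrite lerD // distrC.
have sbE (X : {set I}) :
    Posz (\sum_(i in X) b i) = (M + S)%N%:Z *+ #|X| + \sum_(i in X) p i.
  rewrite (big_morph Posz PoszD (erefl _)) -sumr_const -big_split /=.
  by apply: eq_bigr => i _.
by apply/eqP; rewrite -eqz_nat !sbE cB e.
Qed.

(** * Subsets of sets of real numbers *)

Section RealFamilies.
Variables (R : archiRealFieldType) (I : finType) (a : I -> R).
Hypothesis inja : injective a.

(** All sets of the family have the same sum in the integer model. *)
Lemma real_even_case (D : {set I}) h k x : #|D| = h.*2 -> (0 < k <= h)%N ->
  ((#|sum_family a D k x| * h.*2) ^ 2 * k <= 32 * 132 ^ 2 * 'C(h.*2, k) ^ 2)%N.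
Proof.
move=> cD kh; have [b [M [A [injb bM hA bP]]]] := integer_model h inja.
have [->|/set0Pn[B0 B0F]] := eqVneq (sum_family a D k x) set0.
  by rewrite cards0 mul0n exp0n.
have := B0F; rewrite inE => /and3P[_ /eqP c0 /eqP s0].
apply: leq_trans (@even_case I b D h k (\sum_(i in B0) b i) injb cD kh M A bM hA).
rewrite leq_mul2r leq_exp2r // leq_mul2r; apply/orP; right; apply/orP; right.
apply/subset_leq_card/subsetP => B; rewrite !inE => /and3P[-> /eqP cB /eqP sB].
by rewrite cB eqxx (bP B B0) ?eqxx // ?cB ?sB.
Qed.

(** Count the pairs of a set of the family and an element of [D] outside of it. *)
Lemma sum_family_deletion (D : {set I}) k x : (k <= #|D|)%N ->
  ((#|D| - k) * #|sum_family a D k x| =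
   \sum_(i in D) #|sum_family a (D :\ i) k x|)%N.
Proof.
move=> kD; rewrite mulnC -sum_nat_const.
transitivity (\sum_(B in sum_family a D k x) \sum_(i in D) (i \notin B : nat))%N.
  apply: eq_bigr => B; rewrite inE => /and3P[BD /eqP <- _].
  rewrite -[X in (X - _)%N](cardsID B) (setIidPr BD) addKn.
  rewrite -big_mkcondr -sum1_card; apply: eq_bigl => i.
  by rewrite !inE andbC.
rewrite exchange_big /=; apply: eq_bigr => i iD.
rewrite -big_mkcondr -sum1_card; apply: eq_bigl => B.
by rewrite !inE subsetD1 -!andbA [(i \notin B) && _]andbC -!andbA.
Qed.

(** For odd [#|D|], some deletion keeps at least the average number of sets, and
    [(#|D| - k) C(#|D|, k) = #|D| C(#|D| - 1, k)] is the same average for the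
    family of all sets.  The factor 4 comes from [#|D| <= 2 (#|D| - 1)]. *)
Lemma real_half_case (D : {set I}) k x : (0 < k)%N -> (k.*2 <= #|D|)%N ->
  ((#|sum_family a D k x| * #|D|) ^ 2 * k
    <= 4 * (32 * 132 ^ 2) * 'C(#|D|, k) ^ 2)%N.
Proof.
move=> k0 kD.
have even (D' : {set I}) : ~~ odd #|D'| -> (k.*2 <= #|D'|)%N ->
    ((#|sum_family a D' k x| * #|D'|) ^ 2 * k
      <= 32 * 132 ^ 2 * 'C(#|D'|, k) ^ 2)%N.
  move=> ev kD'; have E : #|D'| = (#|D'|./2).*2.
    by rewrite -[LHS]odd_double_half (negbTE ev).
  by have := @real_even_case D' #|D'|./2 k x E; rewrite -E; apply; lia.
move: (32 * 132 ^ 2)%N even => K even.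
have [oD|eD] := boolP (odd #|D|); last first.
  apply: leq_trans (even D eD kD) _.
  by rewrite leq_mul2r; apply/orP; right; rewrite leq_pmull.
have D0 : (0 < #|D|)%N by lia.
have [i iD maxE] := eq_bigmax_cond (fun i => #|sum_family a (D :\ i) k x|) D0.
have kn : (k <= #|D|)%N by lia.
have := sum_family_deletion x kn.
have cDi : #|D :\ i| = #|D|.-1 by rewrite (cardsD1 i D) iD.
have := even (D :\ i); rewrite cDi => /(_ ltac:(lia) ltac:(lia)).
have := mul_bin_down #|D| k.
have : (\sum_(j in D) #|sum_family a (D :\ j) k x|
    <= #|D| * #|sum_family a (D :\ i) k x|)%N.
  by rewrite -maxE -sum_nat_const; apply: leq_sum => j jD; apply: leq_bigmax_cond.
have n1 : (#|D| <= 2 * #|D|.-1)%N by lia.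
have nk : (0 < #|D| - k)%N by lia.
move: #|D| #|D|.-1 (#|D| - k)%N n1 nk => n n' r n1 r0.
move: (\sum_(j in D) _)%N 'C(n, k) 'C(n', k) => s c c' le_s cE ev sE.
move: #|sum_family a D k x| #|sum_family a (D :\ i) k x| le_s ev sE => N N' le_s ev sE.
rewrite -sE in le_s.
rewrite -(@leq_pmul2r (r ^ 2)) ?expn_gt0 ?r0 //.
have -> : ((N * n) ^ 2 * k * r ^ 2 = (r * N) ^ 2 * (n ^ 2 * k))%N by ring.
apply: (@leq_trans ((n * N') ^ 2 * ((2 * n') ^ 2 * k))).
  by rewrite leq_mul ?leq_exp2r // leq_mul2r leq_exp2r // n1 orbT.
have -> : ((n * N') ^ 2 * ((2 * n') ^ 2 * k) = 4 * n ^ 2 * ((N' * n') ^ 2 * k))%N by ring.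
have -> : (4 * K * c ^ 2 * r ^ 2 = 4 * K * (r * c) ^ 2)%N by ring.
rewrite -cE; have -> : (4 * K * (n * c') ^ 2 = 4 * n ^ 2 * (K * c' ^ 2))%N by ring.
by rewrite leq_mul2l ev orbT.
Qed.

Lemma sum_family_compl (D : {set I}) k x : (k <= #|D|)%N ->
  (#|sum_family a D k x|
    <= #|sum_family a D (#|D| - k) (\sum_(i in D) a i - x)|)%N.
Proof.
move=> kD.
have inj : {in sum_family a D k x &, injective (fun B => D :\: B)}.
  move=> B B'; rewrite !inE => /and3P[BD _ _] /and3P[BD' _ _] e.
  have DDK (X : {set I}) : X \subset D -> D :\: (D :\: X) = X.
    by move=> XD; rewrite setDDr setDv set0U (setIidPr XD).
  by rewrite -(DDK B BD) -(DDK B' BD') e.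
rewrite -(card_in_imset inj); apply/subset_leq_card/subsetP => _ /imsetP[B BF ->].
move: BF; rewrite !inE => /and3P[BD /eqP <- /eqP <-].
rewrite subsetDl cardsD (setIidPr BD) eqxx /=.
by rewrite [X in _ == X - _](big_setID B) /= (setIidPr BD) addrAC subrr add0r.
Qed.

Lemma real_case (D : {set I}) k x : (0 < k < #|D|)%N ->
  ((#|sum_family a D k x| * #|D|) ^ 2 * minn k (#|D| - k)
    <= 4 * (32 * 132 ^ 2) * 'C(#|D|, k) ^ 2)%N.
Proof.
move=> /andP[k0 kD].
have [k2|k2] := leqP k.*2 #|D|.
  have -> : minn k (#|D| - k) = k by lia.
  exact: real_half_case.
have -> : minn k (#|D| - k) = (#|D| - k)%N by lia.
rewrite -(bin_sub (ltnW kD)).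
have rk0 : (0 < #|D| - k)%N by lia.
have rk2 : ((#|D| - k).*2 <= #|D|)%N by lia.
apply: leq_trans (real_half_case (\sum_(i in D) a i - x) rk0 rk2).
rewrite leq_mul2r leq_exp2r // leq_mul2r; apply/orP; right; apply/orP; right.
exact: sum_family_compl (ltnW kD).
Qed.
End RealFamilies.

Theorem lemma1p8 (R : realType) :
  exists C : R, 0 < C /\
    forall (n k : nat) (A : {fset R}),
      (1 <= k <= n - 1)%N ->
      #|` A|%fset = n ->
      forall x : R,
        unif_prob R (ksubsets A k) [pred B : {set A} | subset_sum B == x]
          <= C / (n%:R * Num.sqrt (minn k (n - k))%:R).
Proof.
exists (Num.sqrt (4 * (32 * 132 ^ 2))%:R); split.
  by rewrite sqrtr_gt0 ltr0n !muln_gt0.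
move=> n k A kn cA x.
have cT : #|[set: A]| = n by rewrite cardsT -cardfE.
have kn' : (0 < k < #|[set: A]|)%N by rewrite cT; lia.
have := @real_case R A val val_inj [set: A] k x kn'.
rewrite cT; move: (4 * _)%N => K.
have -> : sum_family (val : A -> R) [set: A] k x =
    [set w in ksubsets A k | w \in [pred B : {set A} | subset_sum B == x]].
  by apply/setP => B; rewrite !inE subsetT.
rewrite /unif_prob.
have -> : #|ksubsets A k| = 'C(n, k) by rewrite card_draws -cardsT cT.
have m0 : (0 < minn k (n - k))%N by lia.
have c0 : (0 < 'C(n, k))%N by rewrite bin_gt0; lia.
have n0 : (0 < n)%N by lia.
move: #|_| 'C(n, k) (minn _ _) c0 m0 => N c m c0 m0 le_sq.
have cp : 0 < c%:R :> R by rewrite ltr0n.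
have np : 0 < n%:R :> R by rewrite ltr0n.
have sm : 0 < Num.sqrt m%:R :> R by rewrite sqrtr_gt0 ltr0n.
rewrite ler_pdivrMr // mulrAC ler_pdivlMr ?mulr_gt0 //.
rewrite -(@ler_pXn2r _ 2) ?nnegrE ?mulr_ge0 ?sqrtr_ge0 ?ler0n //.
rewrite mulrA !exprMn !sqr_sqrtr ?ler0n // -!natrX -!natrM ler_nat.
by rewrite -expnMn.
Qed.
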